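(* Except for finitely many pairs $(d,k)$, which are effectively computable, there exists an index divisor free prime $p$ for $(d,k)$. Here $(d,k)$ ranges over pairs of integers with $d\ge 3$ and $1\le k\le\lceil\frac{d-2}{2}\rceil$.
   Context: For integers $d\geq 3$, $1\le k\le\lceil\frac{d-2}{2}\rceil$, a prime number $p$ is index divisor free (IDF) for $(d,k)$ if: (i) $p>k$; (ii) $p$ divides $d-r$ for some integer $r$ with $0\le r\le k$ (this $r$ is unique since $p>k$); (iii) for this $r$, $r\nmid v_p(d-r)$, where $v_p$ is the normalized $p$-adic valuation (with the convention that $0$ divides only $0$). *)

(* Defs.v *)
From mathcomp Require Import all_boot.

Set Implicit Arguments.
Unset Strict Implicit.
Unset Printing Implicit Defensive.

(* [uphalf (d - 2)] is the ceiling of (d - 2) / 2; the subtraction is exact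
   since 3 <= d. *)
Definition admissible (d k : nat) : bool :=
  [&& 3 <= d, 1 <= k & k <= uphalf (d - 2)].

(* For an admissible pair, r <= k < d, so [d - r] is exact and positive and
   [logn p (d - r)] is its p-adic valuation.  The r is unique since k < p.
   In [dvdn], 0 divides only 0. *)
Definition index_divisor_free (d k p : nat) : Prop :=
  [/\ prime p, k < p
    & exists r : nat,
        [/\ r <= k, p %| d - r & ~~ (r %| logn p (d - r))]].

(* "Finitely many, effectively computable" exceptional pairs: the list of them
   is to be given as data ({s | ...} in Type, not an existence in Prop). *)
Definition exceptional (d k : nat) : Prop :=
  admissible d k /\ ~ (exists p : nat, index_divisor_free d k p).

(* Main.v *)
Require Import Defs.
From mathcomp Require Import all_boot all_order all_algebra all_field zify ring.

Set Implicit Arguments.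
Unset Strict Implicit.
Unset Printing Implicit Defensive.
Import Order.TTheory GRing.Theory Num.Theory.

(** The pair (d, k) has no index divisor free prime exactly when every prime
    q > k satisfies r | v_q(d - r) for all r <= k ([rough_powers]).  At r = 0
    this says that d is k-smooth; at r >= 2 it says that d - r = c x^r with c
    a product of primes <= k ([split_power]); at r = 1 it says nothing.  The
    aim is an explicit bound on such d, for each k and then for all k at once;
    below that bound the exceptional pairs are found by search.

    Large k.  At most log d / log k of the factors of d (d-1) ... (d-k+1) can
    have a prime factor > k, because such a prime occurs in d - r to the power
    at least r.  So the binomial coefficient C(d, k), whose prime power
    divisors are all <= d, is at most d^(pi(k) + log d / log k), and it is at
    least (d/k)^k.  When d >= k^(3/2) and log d / log k is a small multiple of
    k, this contradicts pi(k) = o(k), which comes from the bound 4^n for the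
    product of the primes <= n ([prime_pi_linear]).  When d < k^(3/2), primes
    above the square root of d divide C(d, k) at most once, and not at all
    between d/3 and k; this is the idea of Erdos's proof of Bertrand's
    postulate, and it gives 3^k <= d^(O(sqrt d)) ([expn3_le_near]).

    Huge d, k >= 14.  Among the even shifts d, d-2, d-4, ... there are at least
    pi(k) + 2 terms, and each is a square times a product of primes <= k.  By
    the pigeonhole principle an even number of them multiply to a square.  A
    monic integral polynomial of even degree with distinct roots takes square
    values only at bounded arguments (Runge's method,
    [square_product_bound]), so log d = O(pi(k) log k).  This is what the
    previous paragraph needs, and it bounds d for each k >= 14
    ([rough_powers_le]).

    Small k.  If k+1 is composite, the condition for (d, k+1) implies that for
    (d, k), so that k = 2, 3, 5, 7, 11, 13 remain.  A large smooth d is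
    divisible by a high power of some prime p <= k.  The equations
    d = c x^m + r, with m | r and finitely many c, are then tested modulo
    small prime powers by a depth first search; two equal square classes c
    bound d ([same_square_class]).  A few families survive because a small d,
    or one with d - r = 0, solves the congruences.  They are d = p x^p + p
    with d smooth, d = x^4 + 4 with d odd and smooth, and d = 7^n, and each is
    settled by an algebraic factorisation. *)

(** * Pairs without an index divisor free prime *)

Definition rough_powers (k d : nat) : Prop :=
  2 * k < d /\
  forall r q, r <= k -> prime q -> k < q -> r %| logn q (d - r).

(** The primes > k are then the primes > k+1, so the condition for k is part
    of the condition for k+1. *)
Lemma rough_powersS k d :
  ~~ prime k.+1 -> rough_powers k.+1 d -> rough_powers k d.
Proof.
move=> npk [kd bad]; split=> [|r q rk pq kq]; first by lia.
apply: bad => //; first by lia.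
rewrite ltn_neqAle kq andbT; apply: contraNneq npk => e.
by rewrite e.
Qed.

Lemma rough_powers_smooth k d p :
  rough_powers k d -> prime p -> p %| d -> p <= k.
Proof.
move=> [kd bad] pp pd; rewrite leqNgt; apply/negP => kp.
have := bad 0 p isT pp kp; rewrite subn0 dvd0n => /eqP.
apply/eqP; rewrite -lt0n logn_gt0 mem_primes pp pd andbT /=; lia.
Qed.

Lemma perfect_power m n : 0 < n ->
    (forall q, prime q -> m %| logn q n) ->
  exists x, n = x ^ m.
Proof.
move=> n0 mlog; exists (\prod_(0 <= p < n.+1) p ^ (logn p n %/ m)).
rewrite (big_morph (expn^~ m) (id1 := 1) (op1 := muln)); first last.
- exact: exp1n.
- by move=> x y; rewrite expnMn.
rewrite -{1}(partnT n0) /partn; apply: eq_big => [p|p _]; first by rewrite inE.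
rewrite -expnM; have [pp|npp] := boolP (prime p); first by rewrite divnK ?mlog.
by rewrite lognE (negbTE npp) div0n mul0n.
Qed.

(** With m = 0 the divisibility hypothesis says that n has no prime outside P,
    and the conclusion is the prime factorisation of n over P. *)
Lemma split_power (P : seq nat) m n : 0 < n -> uniq P -> all prime P ->
    (forall q, prime q -> q \notin P -> m %| logn q n) ->
  exists x, n = \prod_(p <- P) p ^ (logn p n %% m) * x ^ m.
Proof.
elim: P n => [|p P IHP] n n0 /=.
  move=> _ _ mlog; rewrite big_nil; have [|x ->] := @perfect_power m n n0; first by auto.
  by exists x; rewrite mul1n.
move=> /andP[pP uP] /andP[pp prP] mlog.
have [v nv] : exists v, n = p ^ logn p n * v.
  by exists (n %/ p ^ logn p n); rewrite mulnC divnK ?pfactor_dvdnn.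
have pe0 e : 0 < p ^ e by rewrite expn_gt0 prime_gt0.
have v0 : 0 < v by move: n0; rewrite nv muln_gt0 => /andP[].
have pv : logn p v = 0.
  have := congr1 (logn p) nv; rewrite lognM // pfactorK //; lia.
have qv q : q != p -> logn q v = logn q n.
  move=> qp; rewrite [in RHS]nv lognM // lognX.
  by rewrite (logn_prime q pp) (negbTE qp) muln0.
have [|x vx] := IHP v v0 uP prP.
  move=> q pq qP; have [->|qp] := eqVneq q p; first by rewrite pv.
  by rewrite qv // mlog // inE negb_or qp.
exists (p ^ (logn p n %/ m) * x).
rewrite big_cons expnMn -expnM mulnACA -expnD addnC -divn_eq {1}nv; congr (_ * _).
rewrite {1}vx; congr (_ * _); rewrite big_seq [RHS]big_seq; apply: eq_bigr => q qP.
by rewrite qv //; apply: contraNneq pP => <-.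
Qed.

(** * Three exponential equations *)

Lemma only_prime_divisor p n : 0 < n -> (forall q, prime q -> q %| n -> q = p) ->
  n = p ^ logn p n.
Proof.
move=> n0 only_p; rewrite -p_part part_pnat_id // /pnat n0; apply/allP => q.
by rewrite mem_primes => /and3P[pq _ /(only_p q pq) ->]; rewrite inE.
Qed.

(** Modulo q, the order of -x divides both p and q - 1. *)
Lemma root_minus_one p q x : prime q -> odd p -> coprime p q.-1 ->
  q %| x ^ p + 1 -> q %| x + 1.
Proof.
move=> pq op cpq.
have toF n : (q %| n) = (n%:R == 0 :> 'F_q)%R by rewrite (dvdn_pcharf (pchar_Fp pq)).
rewrite !toF !natrD natrX; set X := (x%:R : 'F_q)%R => /eqP e.
have Xp : ((- X) ^+ p = 1)%R.
  by rewrite exprNn -signr_odd op expr1 mulN1r; apply/eqP; rewrite -subr_eq0 -opprD e oppr0.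
have X0 : (- X != 0)%R.
  apply: contraTneq isT => X0; move: Xp; rewrite X0 expr0n.
  by case: p op {cpq e} => // p _ /eqP; rewrite eq_sym oner_eq0.
have Xq : ((- X) ^+ q.-1 = 1)%R.
  apply: (mulfI X0); rewrite -exprS prednK ?prime_gt0 // mulr1.
  by have := expf_card (- X)%R; rewrite card_Fp.
have : ((- X) ^+ gcdn p q.-1 = 1)%R.
  have [|u v uv _] := @egcdnP p q.-1; first by case: p op {cpq Xp e}.
  have := congr1 (fun k => (- X) ^+ k)%R uv; rewrite exprD mulnC exprM Xp expr1n.
  by rewrite mulnC exprM Xq expr1n mul1r.
rewrite (eqP cpq) expr1 => X1; by rewrite -[X]opprK X1 addNr.
Qed.

(** The quotient (x^p + 1) / (x + 1) is the sum of the powers (1 - z)^i with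
    i < p and z = x + 1, expanded here to second order in z.  The first order
    shows that it shares only p with x + 1; the second shows that p divides it
    at most once. *)
Lemma alternating_quotient p x : odd p ->
  exists (phi : nat) (t : int), x ^ p + 1 = (x + 1) * phi /\
    (phi%:Z = p%:Z - (x + 1)%N%:Z * 'C(p, 2)%:Z + (x + 1)%N%:Z ^+ 2 * t)%R.
Proof.
move=> op; pose z : int := (x + 1)%N%:Z.
pose s : int := (\sum_(i < p) (1 - z) ^+ i)%R.
have xs : ((x ^ p + 1)%N%:Z = z * s)%R.
  have -> : ((x ^ p + 1)%N%:Z = - ((1 - z) ^+ p - 1))%R.
    have -> : (1 - z = - (x%:Z))%R by rewrite /z; lia.
    by rewrite exprNn -signr_odd op expr1 PoszD -[Posz (x ^ p)]natz natrX natz; ring.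
  by rewrite subrX1 -/s; ring.
have [t st] : exists t, (s = p%:Z - z * 'C(p, 2)%:Z + z ^+ 2 * t)%R.
  rewrite /s; elim: p {op xs s} => [|p [t IHp]].
    by exists 0%R; rewrite big_ord0 (_ : 'C(0, 2) = 0) //; ring.
  have [u pu] : exists u, ((1 - z) ^+ p = 1 - z * p%:Z + z ^+ 2 * u)%R.
    elim: p {IHp} => [|p [u IHp]]; first by exists 0%R; rewrite expr0; ring.
    by exists (p%:Z + u * (1 - z))%R; rewrite exprSr IHp intS; ring.
  exists (t + u)%R; rewrite big_ord_recr /= IHp pu binS bin1 PoszD intS; ring.
have s0 : (0 <= s)%R by nia.
by exists `|s|%N, t; split; lia.
Qed.

(** The cofactor phi of x + 1 in x^p + 1 has no prime divisor other than p: a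
    prime q with gcd(p, q - 1) = 1 dividing phi divides x + 1, and phi = p
    modulo x + 1.  Since p^2 does not divide phi, phi <= p, which is far below
    its size x^(p-1). *)
Lemma smooth_power_succ p x : prime p -> odd p ->
    (forall q, prime q -> q %| x ^ p + 1 -> q = p \/ coprime p q.-1) ->
  x <= 2.
Proof.
move=> pp op sm; have p2 : 2 < p.
  by rewrite ltn_neqAle prime_gt1 // andbT; apply: contraTneq op => <-.
have [phi [t [xphi phiE]]] := alternating_quotient x op.
have phi0 : 0 < phi by rewrite lt0n; apply/eqP => e; rewrite e muln0 in xphi; lia.
have qx q : prime q -> q %| phi -> coprime p q.-1 -> q %| x + 1.
  by move=> pq qphi cq; apply: (root_minus_one pq op cq); rewrite xphi dvdn_mull.
have only_p q : prime q -> q %| phi -> q = p.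
  move=> pq qphi.
  have [//|cq] : q = p \/ coprime p q.-1 by apply: sm => //; rewrite xphi dvdn_mull.
  have /dvdnP[a xa] := qx q pq qphi cq; have /dvdnP[b phib] := qphi.
  apply/eqP; rewrite -dvdn_prime2 //; apply/dvdnP.
  exists (absz (b%:Z + a%:Z * 'C(p, 2)%:Z - a%:Z ^+ 2 * q%:Z * t)%R).
  suff e : (p%:Z = (b%:Z + a%:Z * 'C(p, 2)%:Z - a%:Z ^+ 2 * q%:Z * t) * q%:Z)%R.
    by have := congr1 absz e; rewrite abszM.
  rewrite xa phib !PoszM in phiE.
  transitivity (b%:Z * q%:Z + a%:Z * q%:Z * 'C(p, 2)%:Z - (a%:Z * q%:Z) ^+ 2 * t)%R.
    by rewrite phiE; ring.
  by ring.
have v1 : logn p phi <= 1.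
  rewrite leqNgt -pfactor_dvdn //; apply/negP => /dvdnP[b phib].
  have /dvdnP[a xa] : p %| x + 1.
    apply: qx => //; first by rewrite phib dvdn_mull // dvdn_mulr.
    by rewrite coprime_sym -(prednK (prime_gt0 pp)) coprimenS.
  have /dvdnP[c cE] : p %| 'C(p, 2) by rewrite prime_dvd_bin.
  have : (p%:Z = (b%:Z + a%:Z * c%:Z - a%:Z ^+ 2 * t) * (p%:Z * p%:Z))%R.
    rewrite xa phib cE !expnS expn0 muln1 !PoszM in phiE.
    transitivity (b%:Z * (p%:Z * p%:Z) + a%:Z * p%:Z * (c%:Z * p%:Z)
                  - (a%:Z * p%:Z) ^+ 2 * t)%R.
      by rewrite phiE; ring.
    by ring.
  move=> /(congr1 absz); rewrite abszM; set K := absz (_ - _)%R.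
  case: K => [|u] /= pE; first by lia.
  have : p * 3 <= p by rewrite {2}pE (leq_trans _ (leq_pmull _ _)) // leq_mul2l p2 orbT.
  lia.
have phip : phi %| p.
  rewrite (only_prime_divisor phi0 only_p).
  by have := dvdn_exp2l p v1; rewrite expn1.
have phile := dvdn_leq (prime_gt0 pp) phip.
rewrite leqNgt; apply/negP => x3.
have : x ^ p < (x + 1) * p.
  by rewrite (leq_trans _ (leq_mul (leqnn _) phile)) // -xphi addn1.
have x3p : 3 ^ p.-1 <= x ^ p.-1 by rewrite leq_exp2r //; lia.
have p3 : 2 * p <= 3 ^ p.-1.
  case: p p2 {pp op sm phi xphi phiE phi0 qx only_p v1 phip phile x3p} => // p /= p2.
  elim: p p2 => // p IH; rewrite ltnS leq_eqVlt => /orP[/eqP<- //|/IH]; rewrite expnS; lia.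
rewrite -[p in x ^ p](prednK (prime_gt0 pp)) expnS.
have : x * (2 * p) <= x * x ^ p.-1 by rewrite leq_mul2l (leq_trans p3) // orbT.
nia.
Qed.

Lemma residue_check q n (P : nat -> bool) : 0 < q -> all P (iota 0 q) -> P (n %% q).
Proof. by move=> q0 /allP; apply; rewrite mem_iota ltn_mod. Qed.

Lemma prime_le7 q : prime q -> q <= 7 -> q \in [:: 2; 3; 5; 7].
Proof. by move=> pq; do 8?[case: q pq => // q pq]. Qed.

(** The primes 2 and 3 do not divide u^2 + 1. *)
Lemma sum_squares_div5 u : ~~ odd u ->
    (forall q, prime q -> q %| u ^ 2 + 1 -> q <= 5) -> 0 < u -> 5 %| u ^ 2 + 1.
Proof.
move=> ou sm u0; have u1 : 1 < u ^ 2 + 1 by rewrite addn1 ltnS expn_gt0 u0.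
have pq := pdiv_prime u1; have qd := pdiv_dvd (u ^ 2 + 1).
have := sm _ pq qd; move: (pdiv _) pq qd => q pq qd q5.
have := prime_le7 pq (leq_trans q5 (isT : 5 <= 7)); rewrite !inE.
case/or4P => /eqP e; rewrite {}e // in qd q5 *.
  by move: qd; rewrite dvdn2 oddD oddX (negbTE ou).
have := @residue_check 3 u (fun r => (r ^ 2 + 1) %% 3 != 0) isT isT.
by rewrite -modnDml modnXm modnDml -/(dvdn _ _) qd.
Qed.

(** Sophie Germain's identity: w^4 + 4 = ((w-1)^2 + 1) ((w+1)^2 + 1).  Both
    factors would be divisible by 5, but their difference is 4 w. *)
Lemma smooth_fourth_power w : odd w ->
  (forall q, prime q -> q %| w ^ 4 + 4 -> q <= 5) -> w <= 1.
Proof.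
case: w => // u; rewrite oddS => ou sm.
have fact4 : u.+1 ^ 4 + 4 = (u ^ 2 + 1) * (u.+2 ^ 2 + 1) by ring.
rewrite ltnS leqn0 -[u == 0]negbK -lt0n; apply/negP => u0.
have d1 : 5 %| u ^ 2 + 1.
  by apply: sum_squares_div5 => // q pq qd; apply: sm; rewrite // fact4 dvdn_mulr.
have d2 : 5 %| u.+2 ^ 2 + 1.
  apply: sum_squares_div5 => //; first by rewrite /= negbK.
  by move=> q pq qd; apply: sm; rewrite // fact4 dvdn_mull.
have := @residue_check 5 u
  (fun r => ((r ^ 2 + 1) %% 5 != 0) || (((r + 2) ^ 2 + 1) %% 5 != 0)) isT isT.
rewrite -modnDml modnXm modnDml -/(dvdn _ _) d1 /=.
have -> : (u %% 5 + 2) ^ 2 + 1 = (u + 2) ^ 2 + 1 %[mod 5].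
  by rewrite -modnDml -modnXm (modnDml u) modnXm modnDml.
by rewrite addn2 -/(dvdn _ _) d2.
Qed.

Lemma logn_eq p v n : prime p -> 0 < n -> p ^ v %| n -> ~~ (p ^ v.+1 %| n) ->
  logn p n = v.
Proof. by move=> pp n0; rewrite !pfactor_dvdn // -leqNgt => *; lia. Qed.

(** Valuations at primes > 7 of a product pass to a factor u that shares no
    such prime with the other one. *)
Lemma seventh_power_cofactor u v m : 0 < u -> 0 < v -> 
  (forall q, prime q -> 7 < q -> m %| logn q (u * v)) ->
  (forall q, prime q -> 7 < q -> q %| u -> ~~ (q %| v)) ->
  forall q, prime q -> q \notin [:: 2; 3; 5; 7] -> m %| logn q u.
Proof.
move=> u0 v0 uv cop q pq qP.
have q7 : 7 < q by rewrite ltnNge; apply: contra qP => /(prime_le7 pq).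
have := uv q pq q7; rewrite lognM //.
have [/(cop _ pq q7) nqv|nqu] := boolP (q %| u).
  by rewrite [logn q v]lognE (negbTE nqv) !andbF addn0.
by rewrite [logn q u]lognE (negbTE nqu) !andbF.
Qed.

(** Reducing at each step keeps the intermediate values below q^2. *)
Definition powmod q y m := iter m (fun z => z * y %% q) (1 %% q).

Lemma powmodE q y m : powmod q y m = y ^ m %% q.
Proof. by rewrite /powmod; elim: m => //= m ->; rewrite modnMml expnSr. Qed.

(** The units that are seventh powers modulo 49 form the subgroup of order 6;
    the inverses of 2 and 8 lie outside it. *)
Lemma no_seventh_power c x : c \in [:: 2; 8] -> (c * x ^ 7) %% 49 != 1.
Proof.
move=> cP.
have chk : all (fun r => all (fun c => (c * powmod 49 r 7) %% 49 != 1) [:: 2; 8])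
               (iota 0 49) by vm_compute.
have /allP/(_ c cP) := residue_check x (isT : 0 < 49) chk.
by rewrite powmodE modnXm modnMmr.
Qed.

Lemma expn_mod_period b m q n : 1 < q -> b ^ m %% q = 1 ->
  b ^ n = b ^ (n %% m) %[mod q].
Proof.
move=> q1 bm; rewrite {1}(divn_eq n m) mulnC expnD expnM -modnMml.
by rewrite -[(_ ^ (n %/ m)) %% q]modnXm bm exp1n (modn_small q1) mul1n.
Qed.

(** The congruences force n = 4 g + 1, so that
    d - 7 = 7 (A - 1) (A + 1) (A^2 + 1) with A = 7^g.  For odd g the factor
    A + 1 is 8 times a seventh power, for even g the factor A^2 + 1 is twice a
    seventh power; both are 1 modulo 49 once g >= 2. *)
Lemma power_of_7_bound n d : d = 7 ^ n -> d %% 16 = 7 -> d %% 5 = 2 ->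
    (forall q, prime q -> 7 < q -> 7 %| logn q (d - 7)) ->
  d <= 7 ^ 5.
Proof.
move=> dE d16 d5 rough.
have [g nE] : exists g, n = 4 * g + 1.
  exists (n %/ 4); have := divn_eq n 4; have : n %% 4 < 4 by rewrite ltn_mod.
  move: d16 d5; rewrite dE (@expn_mod_period 7 4 16) // (@expn_mod_period 7 4 5) //.
  by move: (n %% 4) => [|[|[|[|r]]]] //; lia.
rewrite dE leq_exp2l // nE; have [g1|g2] := leqP g 1; first by lia.
set A := 7 ^ g; have A49 : A %% 49 = 0.
  by apply/eqP; rewrite -[49]/(7 ^ 2) -/(dvdn _ _) dvdn_exp2l.
have A0 : 0 < A by rewrite expn_gt0.
have dE' : d - 7 = 7 * (A - 1) * (A + 1) * (A ^ 2 + 1).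
  rewrite dE nE expnD expn1 mulnC (mulnC 4) expnM -/A.
  case: A A0 {A49} => // a _; rewrite subn1 /=.
  have -> : 7 * a.+1 ^ 4 = 7 * a * (a.+1 + 1) * (a.+1 ^ 2 + 1) + 7 by ring.
  by rewrite addnK.
have A1 : 0 < A - 1 by rewrite subn_gt0 -[1](expn0 7) ltn_exp2l //; lia.
have modA b r q : 1 < q -> 7 ^ b %% q = 1 -> 7 ^ (g %% b) %% q = r -> A %% q = r.
  by move=> q1 e <-; apply: expn_mod_period.
have coprime2 q s t a : prime q -> 7 < q -> t = s * a + 2 ->
    q %| s -> q %| t -> False.
  move=> pq q7 te qs; rewrite te dvdn_addr ?dvdn_mulr // => /dvdn_leq -/(_ isT).
  by lia.
(* The valuations of N at 2, 3, 5, 7 are read off from congruences, so that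
   N = c * x ^ 7. *)
have no_cofactor N c : N %% 49 = 1 -> c \in [:: 2; 8] ->
    (forall q, prime q -> q \notin [:: 2; 3; 5; 7] -> 7 %| logn q N) ->
    [&& c %| N, ~~ (2 * c %| N), ~~ (3 %| N) & ~~ (5 %| N)] -> False.
  move=> N49 cc N7 /and4P[cN c2N N3 N5].
  have N0 : 0 < N by case: N N49 {N7 cN c2N N3 N5}.
  have l0 p : ~~ (p %| N) -> logn p N = 0 by move=> pN; rewrite lognE (negbTE pN) !andbF.
  have [x Nx] := @split_power [:: 2; 3; 5; 7] 7 N N0 isT isT N7.
  have N7' : ~~ (7 %| N) by rewrite /dvdn -(@modn_dvdm 49) // N49.
  have c2 : c = 2 ^ logn 2 N.
    move: cc cN c2N; rewrite !inE => /orP[]/eqP-> cN c2N.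
      by rewrite (@logn_eq 2 1).
    by rewrite (@logn_eq 2 3).
  suff e : N = c * x ^ 7 by have := no_seventh_power x cc; rewrite -e N49 eqxx.
  rewrite Nx !big_cons big_nil !(l0 _ N3, l0 _ N5, l0 _ N7') !muln1; congr (_ * _).
  rewrite {1}c2; congr (_ ^ _).
  move: cc; rewrite c2 !inE => /orP[].
    by rewrite -[2 in X in _ == X]expn1 eqn_exp2l // => /eqP->.
  by rewrite -[8]/(2 ^ 3) eqn_exp2l // => /eqP->.
exfalso.
have sqA : A ^ 2 + 1 = (A - 1) * (A + 1) + 2.
  by case: A A0 {A49 dE' A1 modA} => // a _; rewrite subn1 /=; ring.
have A3 : A %% 3 = 1 by apply: (modA 1); rewrite ?modn1.
have [og|eg] := boolP (odd g).
  have A16 : A %% 16 = 7 by apply: (modA 2); rewrite // modn2 og.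
  have A5 : (A %% 5 == 2) || (A %% 5 == 3).
    rewrite /A (@expn_mod_period 7 4 5) //.
    have : odd (g %% 4) by rewrite odd_mod.
    have : g %% 4 < 4 by rewrite ltn_mod.
    by move: (g %% 4) => [|[|[|[|r]]]].
  apply: (no_cofactor (A + 1) 8) => //; [by lia| |by lia].
  apply: (seventh_power_cofactor (v := 7 * (A - 1) * (A ^ 2 + 1))).
  - by rewrite addn1.
  - by rewrite !muln_gt0 A1 addn1.
  - by move=> q pq q7; rewrite (_ : _ * _ = d - 7) ?rough // dE'; ring.
  move=> q pq q7 qA; apply/negP; rewrite !Euclid_dvdM // => /orP[/orP[q7'|qA1]|qA2].
  + by have := dvdn_leq (isT : 0 < 7) q7'; lia.
  + by apply: (@coprime2 q (A - 1) (A + 1) 1) => //; lia.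
  + by apply: (@coprime2 q (A + 1) (A ^ 2 + 1) (A - 1)) => //; rewrite mulnC.
have sqm q r : A %% q = r -> (A ^ 2 + 1) %% q = (r ^ 2 + 1) %% q.
  by move=> <-; rewrite -[RHS]modnDml modnXm modnDml.
have A4 : (A ^ 2 + 1) %% 4 = 2.
  by rewrite (@sqm 4 1) //; apply: (modA 2); rewrite // modn2 (negbTE eg).
have A3' : (A ^ 2 + 1) %% 3 = 2 by rewrite (sqm _ _ A3).
have A5 : (A ^ 2 + 1) %% 5 = 2.
  rewrite (sqm 5 _ erefl) /A (@expn_mod_period 7 4 5) //.
  have : ~~ odd (g %% 4) by rewrite odd_mod.
  have : g %% 4 < 4 by rewrite ltn_mod.
  by move: (g %% 4) => [|[|[|[|r]]]].
apply: (no_cofactor (A ^ 2 + 1) 2) => //; [by rewrite (sqm _ _ A49)| |by lia].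
apply: (seventh_power_cofactor (v := 7 * (A - 1) * (A + 1))).
- by rewrite addn1.
- by rewrite !muln_gt0 A1 addn1.
- by move=> q pq q7; rewrite (_ : _ * _ = d - 7) ?rough // dE'; ring.
move=> q pq q7 qA; apply/negP; rewrite !Euclid_dvdM // => /orP[/orP[q7'|qA1]|qA2].
+ by have := dvdn_leq (isT : 0 < 7) q7'; lia.
+ by apply: (@coprime2 q (A - 1) (A ^ 2 + 1) (A + 1)) => //.
+ by apply: (@coprime2 q (A + 1) (A ^ 2 + 1) (A - 1)) => //; rewrite mulnC.
Qed.

(** * A residue sieve for k <= 13 *)

(** c (x^2 - y^2) is at most k and at least c x. *)
Lemma same_square_class k d r s c x y : r <= k -> s <= k -> r <> s ->
  d = c * x ^ 2 + r -> d = c * y ^ 2 + s -> d <= k ^ 3 + k.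
Proof.
wlog rs : r s x y / r < s => [wl rk sk rs dx dy|rk sk _ dx dy].
  by case: (ltngtP r s) => // rs'; [apply: (wl r s x y) | apply: (wl s r y x) => // e; lia].
have yx : y < x.
  rewrite ltnNge; apply/negP => xy.
  have : c * x ^ 2 <= c * y ^ 2 by rewrite leq_mul2l leq_sqr xy orbT.
  lia.
have c0 : 0 < c by case: c dx dy => // dx dy; lia.
have cx : c * x <= k.
  have : c * (x ^ 2 - y ^ 2) <= k by rewrite mulnBr; lia.
  apply: leq_trans; rewrite leq_mul2l; apply/orP; right; nia.
have : c * x * x <= k * x by rewrite leq_mul2r cx orbT.
have : x <= k by nia.
rewrite !expnS expn0; nia.
Qed.

Definition constraint := (nat * nat)%type.
(** A cell (q, l) records that d modulo q lies in l. *)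
Definition cell := (nat * seq nat)%type.
(** A fact ((r, m), c) records that d = c x^m + r for some x. *)
Definition fact := (constraint * nat)%type.

Definition avoids (st : seq cell) p r :=
  has (fun e => (p %| e.1) && all (fun x => x %% p != r %% p) e.2) st.

Definition forces (st : seq cell) p r :=
  has (fun e => (p %| e.1) && all (fun x => x %% p == r) e.2) st.

Definition consistent d (st : seq cell) :=
  all (fun e => (0 < e.1) && (d %% e.1 \in e.2)) st.

Definition realized d (f : fact) := exists x, d = f.2 * x ^ f.1.2 + f.1.1.

(** All possible products of the p^(v_p(d - r) mod m); a prime that cannot
    divide d - r according to the known residues contributes nothing. *)
Fixpoint classes (P : seq nat) st (r m : nat) : seq nat :=
  if P is p :: P' then
    [seq p ^ e * c | e <- if avoids st p r then [:: 0] else iota 0 m,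
                     c <- classes P' st r m]
  else [:: 1].

Definition powers q m := undup [seq powmod q y m | y <- iota 0 q].

(** Each table pairs a cell (q, l) with the list of m-th powers modulo q, which
    is computed once for all coefficients c. *)
Definition refine (tables : seq (cell * seq nat)) r c : seq cell :=
  [seq (t.1.1, let im := [seq (c %% t.1.1 * y + r) %% t.1.1 | y <- t.2] in
               [seq x <- t.1.2 | x \in im]) | t <- tables].

(** Two facts that [same_square_class] excludes for large d. *)
Definition clash (facts : seq fact) r m c :=
  (m == 2) && has (fun f => [&& f.1.2 == 2, f.1.1 != r & f.2 == c]) facts.

(** Depth first search over the coefficient c of each constraint in turn.  A
    branch is closed by [good], by a clash, or when some modulus has no residue
    left.  Conditionals replace boolean connectives because a call by value
    evaluation would compute both operands. *)
Fixpoint search P (good : seq cell -> seq fact -> bool) (cons : seq constraint)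
    st facts :=
  if good st facts then true else
  if cons is (r, m) :: cons' then
    let tables := [seq (e, powers e.1 m) | e <- st] in
    all (fun c =>
      if clash facts r m c then true else
      let st' := refine tables r c in
      if has (fun e => nilp e.2) st' then true else
      search P good cons' st' (((r, m), c) :: facts))
    (classes P st r m)
  else false.

Lemma avoidsP d st p r : consistent d st -> avoids st p r -> d %% p != r %% p.
Proof.
move=> /allP cons /hasP[[q l] el /andP[/= pq /allP al]].
have /andP[/= q0 dq] := cons _ el.
by have := al _ dq; rewrite modn_dvdm.
Qed.

Lemma forcesP d st p r : consistent d st -> forces st p r -> d %% p = r.
Proof.
move=> /allP cons /hasP[[q l] el /andP[/= pq /allP al]].
have /andP[/= q0 dq] := cons _ el.
by have := al _ dq; rewrite modn_dvdm // => /eqP.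
Qed.

Lemma refineP d st r m c x : d = c * x ^ m + r -> consistent d st ->
  consistent d (refine [seq (e, powers e.1 m) | e <- st] r c).
Proof.
move=> dE /allP cons; rewrite /refine -map_comp; apply/allP => _ /mapP[[q l] el ->] /=.
have /andP[/= q0 dq] := cons _ el; rewrite q0 mem_filter dq andbT /=.
apply/mapP; exists (x ^ m %% q); last by rewrite -modnDml modnMml modnMmr modnDml -dE.
rewrite mem_undup; apply/mapP; exists (x %% q); first by rewrite mem_iota /= ltn_mod.
by rewrite powmodE modnXm.
Qed.

Lemma classesP P d st r m : 0 < m -> r <= d -> all prime P -> consistent d st ->
  \prod_(p <- P) p ^ (logn p (d - r) %% m) \in classes P st r m.
Proof.
move=> m0 rd /[swap] cons.
elim: P => [|p P IHP] /=; first by rewrite big_nil inE.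
move=> /andP[pp prP]; rewrite big_cons; apply: allpairs_f; last exact: IHP.
case: ifP => [av|_]; last by rewrite mem_iota /= ltn_mod.
have := avoidsP cons av; rewrite inE => dr.
rewrite lognE; case: ifP => [/and3P[_ _ pdr]|_]; last by rewrite mod0n.
by case/negP: dr; rewrite eqn_mod_dvd.
Qed.

Lemma searchP P k good d cons st facts :
    uniq P -> all prime P -> (forall q, prime q -> q <= k -> q \in P) ->
    rough_powers k d -> k ^ 3 + k < d ->
    all (fun c => [&& 0 < c.2, c.2 %| c.1 & c.1 <= k]) cons ->
    consistent d st -> (forall f, f \in facts -> realized d f /\ f.1.1 <= k) ->
    search P good cons st facts ->
  exists st' facts', [/\ consistent d st',
    forall f, f \in facts' -> realized d f & good st' facts'].
Proof.
move=> uP prP allP' [kd bad] dbig.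
elim: cons st facts => [|[r m] cons IH] st facts /=.
  by move=> _ ? real; case: ifP => // ? _; exists st, facts; split => // f /real[].
move=> /andP[/and3P[m0 mr rk] ok] dst real.
case: ifP => [? _|_]; first by exists st, facts; split => // f /real[].
set c := \prod_(p <- P) p ^ (logn p (d - r) %% m).
have rd : r < d by lia.
have [x dx] : exists x, d = c * x ^ m + r.
  have [|q pq qP|x dx] := @split_power P m (d - r) _ uP prP; first by rewrite subn_gt0.
    apply: dvdn_trans mr _; apply: bad => //.
    by rewrite ltnNge; apply: contra qP => /(allP' _ pq).
  by exists x; rewrite -dx subnK // ltnW.
move=> /allP/(_ c (classesP m0 (ltnW rd) prP dst)).
case: ifP => [/andP[/eqP m2 /hasP[[[s m'] c'] /= sf /and3P[/eqP e1 sr /eqP e2]]]|_].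
  have [[y /=] dy sk] := real _ sf; rewrite m2 in dx; rewrite e1 e2 in dy.
  suff : d <= k ^ 3 + k by rewrite leqNgt dbig.
  by apply: (same_square_class (s := s) rk sk _ dx dy) => e; rewrite e eqxx in sr.
have dst' := refineP dx dst.
case: ifP => [/hasP[e /(allP dst')/andP[_ +] /nilP e2]|_]; first by rewrite e2.
apply: IH => // f; rewrite inE => /orP[/eqP->|/real//].
by split=> //; exists x.
Qed.

Definition any_residue q : cell := (q, iota 0 q).

Lemma consistent_start d Q q : 0 < q -> q %| d -> all (leq 1) Q ->
  consistent d ((q, [:: 0]) :: [seq any_residue p | p <- Q]).
Proof.
move=> q0 qd /allP Q0; rewrite /= q0 inE (eqP qd) eqxx /=.
apply/allP => _ /mapP[p pQ ->] /=; have p0 := Q0 _ pQ.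
by rewrite p0 mem_iota /= ltn_mod.
Qed.

(** This provides the starting point of the sieve: a large smooth number is 0
    modulo a fixed high power of one of its primes. *)
Lemma le_or_high_power (P : seq nat) M d : 0 < d -> uniq P -> all prime P ->
    (forall q, prime q -> q %| d -> q \in P) ->
  d <= \prod_(p <- P) p ^ M p \/ exists2 p, p \in P & p ^ M p %| d.
Proof.
move=> d0 uP prP sm.
have [/hasP[p pP pd]|/hasPn no] := boolP (has (fun p => p ^ M p %| d) P).
  by right; exists p.
left; have [|x ->] := @split_power P 0 d d0 uP prP.
  move=> q pq qP; rewrite dvd0n eqn0Ngt logn_gt0 mem_primes pq d0 /=.
  by apply: contra qP; apply: sm.
rewrite expn0 muln1 big_seq [leqRHS]big_seq; apply: leq_prod => p pP.
have pp := allP prP p pP; rewrite modn0 leq_exp2l ?prime_gt1 //.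
by have := no p pP; rewrite pfactor_dvdn // -ltnNge => /ltnW.
Qed.

Definition primes_upto k := [seq p <- iota 0 k.+1 | prime p].

Lemma mem_primes_upto k p : (p \in primes_upto k) = prime p && (p <= k).
Proof. by rewrite mem_filter mem_iota. Qed.

Lemma primes_uptoS n :
  primes_upto n.+1 = if prime n.+1 then rcons (primes_upto n) n.+1 else primes_upto n.
Proof.
rewrite /primes_upto -[n.+2]addn1 iotaD filter_cat /= add0n.
by case: prime; rewrite ?cats1 ?cats0.
Qed.

(** The three endings that congruences cannot exclude.  In the first,
    d = p (x^p + 1) and the primes of d meet the hypothesis of
    [smooth_power_succ]; the second is d = x^4 + 4 with d odd and 5-smooth; in
    the third, d is a power of 7. *)
Definition settled k (st : seq cell) (facts : seq fact) : bool :=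
  [|| has (fun p => if ((p, p), p) \in facts then
        all (fun q => [|| q == p, coprime p q.-1 | avoids st q 0]) (primes_upto k)
        else false) [:: 3; 5; 7],
      [&& k <= 5, ((4, 4), 1) \in facts & avoids st 2 0] |
      [&& k == 7, forces st 16 7, forces st 3 1 & forces st 5 2]].

Lemma settledP k d st facts : rough_powers k d -> 7 < d ->
    consistent d st -> (forall f, f \in facts -> realized d f) ->
  settled k st facts -> d <= 7 ^ 5.
Proof.
move=> bad d7 dst real /or3P[].
- case/hasP => p p357; case: ifP => // /real[x /= dx] /allP chk.
  have [pp op p7] : [/\ prime p, odd p & p <= 7].
    by move: p357; rewrite !inE => /or3P[]/eqP->.
  have x2 : x <= 2.
    apply: (smooth_power_succ pp op) => q pq qx.
    have qd : q %| d by rewrite dx -[X in _ + X]muln1 -mulnDr dvdn_mull.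
    have := chk q; rewrite mem_primes_upto pq (rough_powers_smooth bad pq qd) => /(_ isT).
    case/or3P => [/eqP|?|/(avoidsP dst)]; [by left | by right |].
    by rewrite mod0n -/(dvdn _ _) qd.
  have : p * x ^ p + p <= 7 * 2 ^ 7 + 7.
    rewrite leq_add // leq_mul // (@leq_trans (2 ^ p)) ?leq_exp2l //.
    by case: p pp {op p357 chk dx p7} => // p _; rewrite leq_exp2r.
  rewrite -dx => /leq_trans-> //.
- case/and3P => k5 /real[x /= dx] /(avoidsP dst); rewrite mod0n modn2 eqb0 negbK => od.
  rewrite mul1n in dx.
  have : x <= 1.
    apply: smooth_fourth_power => [|q pq]; first by move: od; rewrite dx oddD oddX addbF.
    by rewrite -dx => /(rough_powers_smooth bad pq) /leq_trans->.
  by move: d7; rewrite dx; case: x {dx} => [|[|]].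
- case/and4P => /eqP k7 /(forcesP dst) d16 /(forcesP dst) d3 /(forcesP dst) d5.
  have only7 q : prime q -> q %| d -> q = 7.
    move=> pq qd.
    have := prime_le7 pq (leq_trans (rough_powers_smooth bad pq qd) (eq_leq k7)).
    rewrite !inE => /or4P[]/eqP e; move: qd; rewrite e // /dvdn.
    - by rewrite -(@modn_dvdm 16) // d16.
    - by rewrite d3.
    - by rewrite d5.
  apply: (@power_of_7_bound (logn 7 d)) => //.
    by apply: only_prime_divisor only7; lia.
  by move=> q pq q7; case: bad => _; apply; rewrite ?k7.
Qed.

(** One search for each prime p <= k, under the assumption that d is 0 modulo
    p^(exps p). *)
Definition sieve k exps aux cons : bool :=
  let P := primes_upto k in
  all (fun p => search P (settled k) cons
    ((p ^ nth 1 exps p, [:: 0]) ::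
     [seq any_residue q | q <- aux & coprime q p]) [::]) P.

Lemma sieve_bound k exps aux cons :
    all (leq 1) aux ->
    all (fun c => [&& 0 < c.2, c.2 %| c.1 & c.1 <= k]) cons ->
    sieve k exps aux cons ->
  {B | forall d, rough_powers k d -> d <= B}.
Proof.
move=> aux0 ok /allP chk; set P := primes_upto k.
pose D := \prod_(p <- P) p ^ nth 1 exps p.
exists (maxn (maxn D (k ^ 3 + k)) (maxn 7 (7 ^ 5))) => d bad.
rewrite leqNgt !gtn_max; apply/negP => /andP[/andP[dD dk] /andP[d7 d75]].
have [] := @le_or_high_power P (nth 1 exps) d;
  rewrite ?filter_uniq ?iota_uniq ?filter_all //.
- by lia.
- by move=> q pq qd; rewrite mem_primes_upto pq (rough_powers_smooth bad pq qd).
- by rewrite leqNgt dD.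
case=> p pP pd; have := chk p pP.
have [pp _] := andP (etrans (esym (mem_primes_upto k p)) pP).
case/(@searchP P k (settled k) d).
- by rewrite filter_uniq ?iota_uniq.
- exact: filter_all.
- by move=> q pq qk; rewrite mem_primes_upto pq.
- exact: bad.
- exact: dk.
- exact: ok.
- apply: consistent_start; rewrite ?expn_gt0 ?prime_gt0 //.
  by apply/allP => q; rewrite mem_filter => /andP[_ /(allP aux0)].
- by [].
move=> st [facts [dst real /(settledP bad d7 dst real)]].
by rewrite leqNgt d75.
Qed.

(** Indexed by the prime itself, with default exponent 1. *)
Definition exps := [:: 0; 0; 6; 3; 0; 2; 0; 2].

(** A constraint (r, m) may use any m dividing r, and any m at all for r = 0.
    Squares come first because clashes between them prune the most. *)
Lemma bounded_2 : {B | forall d, rough_powers 2 d -> d <= B}.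
Proof.
apply: (@sieve_bound 2 exps [::] [:: (2, 2)]).
- by [].
- by [].
- by vm_compute.
Qed.

Lemma bounded_3 : {B | forall d, rough_powers 3 d -> d <= B}.
Proof.
apply: (@sieve_bound 3 exps [:: 64; 9] [:: (0, 2); (2, 2); (3, 3)]).
- by [].
- by [].
- by vm_compute.
Qed.

Lemma bounded_5 : {B | forall d, rough_powers 5 d -> d <= B}.
Proof.
apply: (@sieve_bound 5 exps [:: 64; 9; 5; 7; 11; 13]
  [:: (0, 2); (2, 2); (4, 2); (4, 4); (3, 3); (0, 3); (5, 5)]).
- by [].
- by [].
- by vm_compute.
Qed.

Lemma bounded_7 : {B | forall d, rough_powers 7 d -> d <= B}.
Proof.
apply: (@sieve_bound 7 exps [:: 64; 9; 5; 7]
  [:: (0, 2); (2, 2); (4, 2); (6, 2); (4, 4); (3, 3); (5, 5)]).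
- by [].
- by [].
- by vm_compute.
Qed.

Lemma bounded_11 : {B | forall d, rough_powers 11 d -> d <= B}.
Proof.
apply: (@sieve_bound 11 exps [:: 64; 9; 5; 7; 11]
  [:: (2, 2); (4, 2); (6, 2); (8, 2); (10, 2); (0, 2); (3, 3); (9, 3); (7, 7)]).
- by [].
- by [].
- by vm_compute.
Qed.

Lemma bounded_13 : {B | forall d, rough_powers 13 d -> d <= B}.
Proof.
apply: (@sieve_bound 13 exps [:: 64; 9; 5; 7; 11; 13]
  [:: (2, 2); (4, 2); (6, 2); (8, 2); (10, 2); (12, 2); (0, 2); (3, 3); (9, 3)]).
- by [].
- by [].
- by vm_compute.
Qed.

(** * Products of linear factors that are squares *)

Local Open Scope ring_scope.

Lemma norm_horner_le (p : {poly int}) n (W x : int) : (size p <= n)%N ->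
  (forall i, `|p`_i| <= W) -> 1 <= x -> `|p.[x]| <= n%:R * W * x ^+ n.-1.
Proof.
move=> sp pW x1; rewrite (horner_coef_wide _ sp).
apply: le_trans (ler_norm_sum _ _ _) _.
rewrite -mulrA mulr_natl -[n in _ *+ n]card_ord -sumr_const; apply: ler_sum => i _.
have x0 : 0 <= x by lia.
rewrite normrM normrX (ger0_norm x0) ler_pM ?exprn_ge0 //.
by rewrite ler_weXn2l //; case: n i {sp} => [[]|n] // i; rewrite /= -ltnS.
Qed.

Lemma horner_neq0 (p : {poly int}) n (W x : int) : (size p <= n)%N -> p != 0 ->
  (forall i, `|p`_i| <= W) -> 1 <= x -> n%:R * W < x -> p.[x] != 0.
Proof.
move=> sp p0 pW x1 xW; pose m := (size p).-1.
have sm : size p = m.+1 by rewrite /m prednK // size_poly_gt0.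
have W0 : 0 <= W by apply: le_trans (pW 0%N).
have qW : forall i, `|(\poly_(i < m) p`_i)`_i| <= W.
  by move=> i; rewrite coef_poly; case: ifP; rewrite ?normr0.
have low := norm_horner_le (size_poly m _) qW x1.
apply/eqP => px; move: px; rewrite horner_coef sm big_ord_recr /= => px.
have {low} : `|p`_m * x ^+ m| <= m%:R * W * x ^+ m.-1.
  apply: le_trans low; rewrite horner_poly.
  have -> : p`_m * x ^+ m = - \sum_(i < m) p`_i * x ^+ i.
    by apply/eqP; rewrite -addr_eq0 addrC px.
  by rewrite normrN.
have lead : 1 <= `|p`_m|.
  have : p`_m != 0 by rewrite -[m]/((size p).-1) -lead_coefE lead_coef_eq0.
  lia.
have x0 : 0 < x by lia.
rewrite normrM normrX (gtr0_norm x0); apply/negP; rewrite -ltNge.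
have xm : 0 < x ^+ m.-1 by rewrite exprn_gt0.
case: m sm lead xm {qW px} => [|m] sm lead xm.
  by rewrite mul0r mul0r expr0 mulr1; lia.
apply: (@lt_le_trans _ _ (x * x ^+ m)).
  rewrite ltr_pM2r //; apply: le_lt_trans xW.
  by rewrite ler_wpM2r // ler_nat; rewrite sm in sp; apply: ltnW.
by rewrite exprS; apply: ler_peMl => //; rewrite mulr_ge0 // ltW.
Qed.

(** Solves g + z g^2 = c as power series up to order N.  In this form the
    square root of 1 + 4 z c is 1 + 2 z g, with integral coefficients. *)
Lemma convolution_root (c : nat -> int) N : exists g : nat -> int,
  forall n, (n < N)%N -> g n = c n - \sum_(i < n) g i * g (n.-1 - i)%N.
Proof.
elim: N => [|N [g gN]]; first by exists (fun=> 0).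
exists (fun n => if n == N then c N - \sum_(i < N) g i * g (N.-1 - i)%N else g n).
move=> n; rewrite ltnS leq_eqVlt => /predU1P[->|nN].
  rewrite eqxx; congr (_ - _); apply: eq_bigr => i _.
  by rewrite !ltn_eqF //; have := ltn_ord i; lia.
rewrite (ltn_eqF nN) gN //; congr (_ - _); apply: eq_bigr => i _.
by rewrite !ltn_eqF //; have := ltn_ord i; lia.
Qed.

(** The bound M (N M)^n is stable under the recursion: the convolution has n
    terms, each at most M^2 (N M)^(n-1), and n + 1 <= N. *)
Lemma convolution_root_le (c g : nat -> int) N (M : int) : 1 <= M ->
    (forall n, (n < N)%N -> `|c n| <= M ^+ n.+1) ->
    (forall n, (n < N)%N -> g n = c n - \sum_(i < n) g i * g (n.-1 - i)%N) ->
  forall n, (n < N)%N -> `|g n| <= M * (N%:R * M) ^+ n.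
Proof.
move=> M1 cM gE; elim/ltn_ind => n IH nN; rewrite gE //.
have M0 : 0 <= M by lia.
have N1 : 1 <= N%:R :> int by rewrite ler1n; lia.
case: n nN IH => [|n] nN IH.
  by rewrite big_ord0 subr0 expr0 mulr1 (le_trans (cM _ nN)) ?expr1.
apply: le_trans (ler_normB _ _) _.
have s : `|\sum_(i < n.+1) g i * g (n - i)%N| <= n.+1%:R * (M * M * (N%:R * M) ^+ n).
  apply: le_trans (ler_norm_sum _ _ _) _.
  rewrite mulr_natl -[X in _ *+ X]card_ord -sumr_const; apply: ler_sum => i _.
  have i1 : (i < n.+1)%N by [].
  have -> : (N%:R * M) ^+ n = (N%:R * M) ^+ i * (N%:R * M) ^+ (n - i).
    by rewrite -exprD subnKC // -ltnS.
  rewrite normrM mulrACA.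
  by rewrite ler_pM // IH //; lia.
have cn : `|c n.+1| <= M * M * (N%:R * M) ^+ n.
  apply: le_trans (cM _ nN) _; rewrite !exprS mulrA ler_wpM2l ?mulr_ge0 //.
  by rewrite lerXn2r ?nnegrE ?mulr_ge0 // ?ler_peMl // ler0n.
apply: le_trans (lerD cn s) _.
set P := (_ * M) ^+ n.
have -> : M * (N%:R * M) ^+ n.+1 = N%:R * (M * M * P) by rewrite exprS -/P; ring.
have -> : M * M * P + n.+1%:R * (M * M * P) = n.+2%:R * (M * M * P).
  by rewrite -[n.+2%:R]natr1; ring.
by rewrite ler_wpM2r ?ler_nat // !mulr_ge0 // exprn_ge0 // mulr_ge0.
Qed.

(** The factor 4 in the roots makes all lower coefficients divisible by 4, which
    is what an integral square root needs. *)
Lemma prod_factors_coef (A : seq nat) (k : nat) (n := size A) :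
    {in A, forall a, a <= k}%N ->
  exists F : {poly int}, [/\ \prod_(a <- A) ('X - (4 * a%:R)%:P) = 'X^n + 4 *: F,
    (size F <= n)%N &
    forall i, (i < n)%N -> `|F`_i| <= (4 * n%:R * k%:R) ^+ (n - i)].
Proof.
rewrite {}/n; elim: A => [|a A IH] Ak.
  by exists 0; rewrite big_nil expr0 scaler0 addr0 size_poly0.
have [|F [FE sF Fle]] := IH; first by move=> b bA; rewrite Ak // inE bA orbT.
have ak : (a <= k)%N by rewrite Ak // inE eqxx.
set n := size A in FE sF Fle *.
pose F' : {poly int} := 'X * F - a%:R *: 'X^n - (4 * a%:R) *: F.
exists F'; rewrite /F'; split.
- rewrite big_cons FE exprS !scalerBr !scalerA /= -!mul_polyC !polyCM.
  by rewrite -/n; ring.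
- have sXn : (size ('X * F)%R <= n.+1)%N.
    have [->|F0] := eqVneq F 0; first by rewrite mulr0 size_poly0.
    by rewrite mulrC size_mulX.
  rewrite (leq_trans (size_polyD _ _)) // geq_max size_polyN; apply/andP; split.
    rewrite (leq_trans (size_polyD _ _)) // geq_max sXn size_polyN.
    by rewrite (leq_trans (size_scale_leq _ _)) // size_polyXn.
  by rewrite (leq_trans (size_scale_leq _ _)) // (leq_trans sF).
move=> i; rewrite ltnS => lein /=; rewrite -/n.
rewrite !coefB !coefZ coefXM coefXn.
have k0 : 0 <= k%:R :> int by rewrite ler0n.
have n0 : 0 <= n%:R :> int by rewrite ler0n.
have aK : (a%:R : int) <= k%:R by rewrite ler_nat.
have a0 : 0 <= a%:R :> int by rewrite ler0n.
have Fi1 : `|if i == 0%N then 0 else F`_i.-1| <= (4 * n%:R * k%:R) ^+ (n.+1 - i).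
  case: i lein => [|i] lein /=; first by rewrite normr0 exprn_ge0 // !mulr_ge0.
  by rewrite subSS; apply: Fle.
have [ein|nin] := eqVneq i n.
  have -> : F`_i = 0 by rewrite nth_default // ein.
  have -> : (n.+1 - i)%N = 1%N by rewrite ein subSnn.
  have {Fi1} : `|if i == 0%N then 0 else F`_i.-1| <= 4 * n%:R * k%:R.
    by move: Fi1; rewrite ein subSnn expr1.
  move=> Fi1; rewrite expr1.
  rewrite -[n.+1%:R]natr1 mulr0 subr0 mulr1.
  apply: le_trans (ler_normB _ _) _; rewrite (ger0_norm a0).
  apply: le_trans (lerD Fi1 aK) _; nia.
have iltn : (i < n)%N by rewrite ltn_neqAle nin.
rewrite mulr0 subr0; apply: le_trans (ler_normB _ _) _.
rewrite normrM (@ger0_norm _ (4 * _)) ?mulr_ge0 //.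
have b2 : 4 * a%:R * `|F`_i| <= 4 * k%:R * (4 * n%:R * k%:R) ^+ (n - i).
  by rewrite ler_pM ?mulr_ge0 // ?Fle //; lia.
apply: le_trans (lerD Fi1 b2) _; rewrite subSn // !exprS -mulrDl -[n.+1%:R]natr1.
have -> : 4 * n%:R * k%:R + 4 * k%:R = 4 * (n%:R + 1) * k%:R :> int by ring.
rewrite ler_wpM2l //; first by rewrite !mulr_ge0 // addr_ge0.
rewrite lerXn2r ?nnegrE ?mulr_ge0 // ?addr_ge0 //.
by rewrite ler_wpM2r // ler_wpM2l // lerDl.
Qed.

Lemma prod_factors_nonsquare (A : seq nat) (G : {poly int}) : uniq A -> A != [::] ->
  \prod_(a <- A) ('X - (4 * a%:R)%:P) != G ^+ 2.
Proof.
case: A => // a A /= /andP[aA uA] _; apply/eqP; rewrite big_cons => e.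
have rG : root G (4 * a%:R).
  have : root (G ^+ 2) (4 * a%:R) by rewrite -e rootM root_XsubC eqxx.
  by rewrite expr2 rootM orbb.
have [H GH] := factor_theorem _ _ rG.
have : \prod_(b <- A) ('X - (4 * b%:R)%:P) = H ^+ 2 * ('X - (4 * a%:R : int)%:P).
  by apply: (mulfI (negbT (polyXsubC_eq0 (4 * a%:R : int)))); rewrite e GH; ring.
move/(congr1 (fun p => root p (4 * a%:R))).
rewrite [in RHS]rootM root_XsubC eqxx orbT.
have -> : \prod_(b <- A) ('X - (4 * b%:R)%:P) =
   \prod_(z <- [seq (4 * b%:R : int) | b <- A]) ('X - z%:P) by rewrite big_map.
rewrite root_prod_XsubC => /mapP[b bA] /eqP.
by rewrite (inj_eq (mulfI _)) // eqr_nat => /eqP e'; rewrite e' bA in aA.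
Qed.

(** Completing the square: Q is the integral polynomial for which the difference
    with ('X^h + 2 Q)^2 has degree < h.  Its coefficients are those of the
    power series of [convolution_root], in reverse order. *)
Lemma square_part (A : seq nat) h k : size A = (2 * h)%N -> (0 < h)%N -> (0 < k)%N ->
    {in A, forall a, a <= k}%N ->
  exists Q S : {poly int},
    [/\ \prod_(a <- A) ('X - (4 * a%:R)%:P) = ('X^h + 2 *: Q) ^+ 2 + 4 *: S,
        (size Q <= h)%N, (size S <= h)%N,
        forall i, `|Q`_i| <= (8 * h ^ 2 * k)%:R ^+ h &
        forall i, `|S`_i| <= h.+1%:R * (8 * h ^ 2 * k)%:R ^+ (2 * h)].
Proof.
move=> sA h0 k0 /prod_factors_coef[F []]; rewrite sA => FE sF Fle.
pose M : int := (8 * h * k)%:R; set N : int := (8 * h ^ 2 * k)%:R.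
have M1 : 1 <= M by rewrite ler1n !muln_gt0 h0.
have hM : h%:R * M = N by rewrite /M /N -natrM; congr (_%:R); ring.
have N1 : 1 <= N by rewrite ler1n !muln_gt0 h0.
have MN : M <= N by rewrite ler_nat; nia.
have N0 : 0 <= N by lia.
have FM i : (i < 2 * h)%N -> `|F`_i| <= M ^+ (2 * h - i).
  have -> : M = 4 * (2 * h)%:R * k%:R by rewrite /M !natrM; ring.
  exact: Fle.
pose c j := F`_(2 * h - j.+1).
have [g gE] := convolution_root c h.
have cM n : (n < h)%N -> `|c n| <= M ^+ n.+1.
  by move=> nh; apply: le_trans (FM _ _) _; [lia|]; rewrite subKn //; lia.
have gM := convolution_root_le M1 cM gE.
pose Q := \poly_(i < h) g (h - i.+1)%N.
have QE i : Q`_i = if (i < h)%N then g (h - i.+1)%N else 0 by rewrite coef_poly.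
have Qle i : `|Q`_i| <= N ^+ h.
  rewrite QE; case: ifP => ih; last by rewrite normr0 exprn_ge0.
  apply: (le_trans (gM _ _)); first by lia.
  rewrite hM; apply: (@le_trans _ _ (N * N ^+ (h - i.+1))).
    by rewrite ler_wpM2r // exprn_ge0.
  by rewrite -exprS; apply: ler_weXn2l => //; lia.
have sQ : (size Q <= h)%N by exact: size_poly.
have sS : (size (F - 'X^h * Q - Q ^+ 2)%R <= h)%N.
  apply/leq_sizeP => m hm.
  rewrite !coefB coefXnM ltnNge hm /= expr2 coefM.
  have [big|small] := leqP (2 * h) m.
    rewrite nth_default; last exact: leq_trans sF big.
    rewrite QE ifF; last by apply/negbTE; rewrite -leqNgt; lia.
    rewrite big1 ?subrr // => i _; rewrite !QE.
    have := ltn_ord i => im.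
    case: ifP => i1; last by rewrite mul0r.
    by case: ifP => i2; [lia | rewrite mulr0].
  pose n := (2 * h - m.+1)%N.
  have nh : (n < h)%N by rewrite /n; lia.
  have mE : m = (2 * h - n.+1)%N by rewrite /n; lia.
  rewrite QE ifT; last by lia.
  have -> : (h - (m - h).+1)%N = n by rewrite /n; lia.
  rewrite gE // -/(c n) {1}mE -/(c n).
  rewrite subKr; apply/eqP; rewrite subr_eq0; apply/eqP.
  (* Only the indices from h - n to h - 1 have both factors nonzero. *)
  rewrite -[RHS](big_mkord predT (fun i => Q`_i * Q`_(m - i))).
  rewrite (@big_cat_nat _ _ _ (h - n)) //=; last by lia.
  rewrite [X in _ = X + _]big_nat_cond [X in _ = X + _]big1 ?add0r; last first.
    move=> i /andP[/andP[_ i1] _]; rewrite !QE [X in _ * X]ifF ?mulr0 //.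
    by apply/negbTE; rewrite -leqNgt; lia.
  rewrite (@big_cat_nat _ _ _ h) //=; [|by lia|by lia].
  rewrite [X in _ = _ + X]big_nat_cond [X in _ = _ + X]big1 ?addr0; last first.
    move=> i /andP[/andP[i1 _] _]; rewrite !QE ifF ?mul0r //.
    by apply/negbTE; rewrite -leqNgt.
  rewrite -[(h - n)%N]add0n big_addn subKn; last by lia.
  rewrite big_mkord; apply: eq_bigr => t _; have tn := ltn_ord t.
  rewrite !QE !ifT; [|by lia|by lia].
  by rewrite mulrC; congr (g _ * g _); lia.
exists Q, (F - 'X^h * Q - Q ^+ 2); split => //.
  rewrite FE mulnC exprM -!mul_polyC; ring.
move=> i; have NW : 0 <= N ^+ (2 * h) by rewrite exprn_ge0.
have [hi|ih] := leqP h i.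
  by rewrite nth_default ?normr0 ?mulr_ge0 //; apply: leq_trans sS hi.
rewrite !coefB coefXnM ih subr0.
have sumle : `|(Q ^+ 2)`_i| <= h%:R * N ^+ (2 * h).
  rewrite expr2 coefM; apply: le_trans (ler_norm_sum _ _ _) _.
  apply: (@le_trans _ _ (i.+1%:R * N ^+ (2 * h))); last by rewrite ler_wpM2r // ler_nat.
  rewrite mulr_natl -[X in _ *+ X]card_ord -sumr_const; apply: ler_sum => j _.
  by rewrite mul2n -addnn exprD normrM ler_pM.
have Fi : `|F`_i| <= N ^+ (2 * h).
  apply: le_trans (FM _ _) _; first by lia.
  apply: (@le_trans _ _ (N ^+ (2 * h - i))).
    by rewrite lerXn2r ?nnegrE //; lia.
  by apply: ler_weXn2l => //; lia.
apply: le_trans (ler_normB _ _) _; apply: le_trans (lerD Fi sumle) _.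
by rewrite -[h.+1%:R]natr1 mulrDl mul1r addrC.
Qed.

(** Runge's method.  At x = 4 d the product of the factors is
    (4^h y)^2 = G^2 + 4 S(x), where G has size x^h and S has degree < h.  If x
    is large then S(x) is nonzero and smaller than the gap between G^2 and the
    neighbouring squares. *)
Lemma square_product_bound (A : seq nat) (h k d y : nat) :
    size A = (2 * h)%N -> (0 < h)%N -> (0 < k)%N -> uniq A ->
    {in A, forall a, a <= k}%N -> (k <= d)%N ->
    (\prod_(a <- A) (d - a) = y ^ 2)%N ->
  (d <= 2 * h * h.+1 * (8 * h ^ 2 * k) ^ (2 * h))%N.
Proof.
move=> sA h0 k0 uA Ak kd prody; rewrite leqNgt; apply/negP => dbig.
have [Q [S [fE sQ sS Qle Sle]]] := square_part sA h0 k0 Ak.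
set N : int := (8 * h ^ 2 * k)%:R in Qle Sle.
have N1 : 1 <= N by rewrite ler1n !muln_gt0 h0.
pose W := h.+1%:R * N ^+ (2 * h); pose x : int := 4 * d%:R.
have W1 : 1 <= W by rewrite /W mulr_ege1 ?exprn_ege1 // ler1n.
have xW : 8 * (h%:R * W) < x.
  move: dbig; rewrite -(ltr_nat int) !natrM natrX -/N => dbig'.
  have -> : 8 * (h%:R * W) = 4 * (2 * h%:R * h.+1%:R * N ^+ (2 * h)) by rewrite /W; ring.
  by rewrite /x ltr_pM2l.
have QW i : `|Q`_i| <= W.
  apply: le_trans (Qle i) _; apply: (@le_trans _ _ (N ^+ (2 * h))).
    by apply: ler_weXn2l => //; lia.
  by rewrite /W ler_peMl // ?exprn_ge0 ?ler1n //; lia.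
have x1 : 1 <= x by rewrite /x; lia.
have h1 : 1 <= h%:R :> int by rewrite ler1n.
have q := norm_horner_le sQ QW x1; have s := norm_horner_le sS Sle x1.
have S0 : S != 0.
  apply/eqP => S0; have := @prod_factors_nonsquare A ('X^h + 2 *: Q) uA.
  rewrite fE S0 scaler0 addr0 eqxx => /(_ _)/negP; case=> //.
  by apply: contraTneq h0 => A0; rewrite A0 /= in sA; lia.
have s0 : S.[x] != 0 by apply: (horner_neq0 sS S0 Sle x1); rewrite -/W;
  apply: le_lt_trans xW; rewrite ler_peMl // mulr_ge0 //; lia.
have Y : ((4 ^ h * y)%N%:R) ^+ 2 = (x ^+ h + 2 * Q.[x]) ^+ 2 + 4 * S.[x].
  have := congr1 (fun p : {poly int} => p.[x]) fE.
  rewrite !hornerE => <-.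
  rewrite horner_prod -natrX expnMn -prody -expnM mulnC [(h * 2)%N]mulnC -sA.
  rewrite natrM natrX.
  elim: (A) Ak => [|a B IH] Ak; first by rewrite !big_nil.
  rewrite !big_cons natrM /= exprS mulrACA IH; last first.
    by move=> b bB; rewrite Ak // inE bB orbT.
  have ad : (a <= d)%N by rewrite (leq_trans _ kd) // Ak // inE eqxx.
  by rewrite !hornerE /x natrB //; congr (_ * _); ring.
move: Y q s s0 xW; rewrite -/W -[in x ^+ h](prednK h0) [x ^+ _]exprS.
have : 1 <= x ^+ h.-1 by rewrite exprn_ege1.
move: (x ^+ h.-1) (Q.[x]) (S.[x]) => t q s; set y' := (_ * y)%N.
have V1 : 1 <= h%:R * W by rewrite mulr_ege1.
have y0 : 0 <= y'%:R :> int by rewrite ler0n.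
move: (h%:R * W) V1 (y'%:R : int) y0 => V V1 Y Y0 t1 YE q1 s1 s0 xV.
have xt : (8 * V + 1) * t <= x * t by rewrite ler_wpM2r; lia.
have Vt : 1 <= V * t by rewrite mulr_ege1.
have [G0 GV] : 0 < x * t + 2 * q /\ 6 * (V * t) + 1 <= x * t + 2 * q by lia.
have s4 : `|4 * s| <= 4 * (V * t) by lia.
move: (x * t + 2 * q) (V * t) G0 GV s4 YE Vt => G Z G0 GZ s4 YE Z1.
(* Here G is the value of 'X^h + 2 Q, positive and at least 6 Z + 1, and the
   remainder 4 s is at most 4 Z in absolute value. *)
have [YG|GY|e] := ltrgtP Y G.
- have : Y ^+ 2 <= (G - 1) ^+ 2 by rewrite lerXn2r ?nnegrE; lia.
  have -> : (G - 1) ^+ 2 = G ^+ 2 - 2 * G + 1 by ring.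
  rewrite YE; move: (G ^+ 2) (4 * s) s4 {YE s0} => g2 s'; lia.
- have : (G + 1) ^+ 2 <= Y ^+ 2 by rewrite lerXn2r ?nnegrE; lia.
  have -> : (G + 1) ^+ 2 = G ^+ 2 + 2 * G + 1 by ring.
  rewrite YE; move: (G ^+ 2) (4 * s) s4 {YE s0} => g2 s'; lia.
move: YE; rewrite e -[LHS]addr0 => /addrI /eqP.
by rewrite eq_sym mulf_eq0 (negbTE s0).
Qed.

Local Close Scope ring_scope.

(** * Square products among even shifts of d *)

Definition prime_pi k := size (primes_upto k).

Lemma prime_piS k : prime_pi k.+1 = prime_pi k + prime k.+1.
Proof.
by rewrite /prime_pi primes_uptoS; case: prime; rewrite ?size_rcons ?addn1 ?addn0.
Qed.

Lemma even_not_prime n : 2 < n -> ~~ odd n -> ~~ prime n.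
Proof.
move=> n2 on; apply/negP => pn; have := prime_oddPn pn; rewrite (negbTE on).
by move/(_ isT) => e; rewrite e in n2.
Qed.

(** Of two consecutive numbers > 2 at most one is prime, so the bound passes from
    k to k + 2; it first holds at 14 and 15. *)
Lemma prime_pi_le_half k : 14 <= k -> prime_pi k + 1 <= k./2.
Proof.
elim/ltn_ind: k => k IH; rewrite leq_eqVlt => /predU1P[<- //|].
rewrite leq_eqVlt => /predU1P[<- //|].
case: k IH => // [[|k]] // IH k14; rewrite !prime_piS.
have {IH} := IH k (ltnW (ltnSn _)) k14.
have [ok|ek] := boolP (odd k).
  by rewrite (negbTE (@even_not_prime k.+1 _ _)) /= ?ok //; [case: prime; lia | lia].
by rewrite (negbTE (@even_not_prime k.+2 _ _)) /= ?ek ?negbK //; [case: prime; lia | lia].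
Qed.

Lemma logn_prod (I : Type) (s : seq I) (P : pred I) (F : I -> nat) q :
  (forall i, 0 < F i) ->
  logn q (\prod_(i <- s | P i) F i) = \sum_(i <- s | P i) logn q (F i).
Proof.
move=> F0; elim: s => [|i s IH]; first by rewrite !big_nil logn1.
rewrite !big_cons; case: ifP => // _; rewrite lognM ?IH // prodn_gt0 //.
Qed.

Lemma odd_sum_xor (I : finType) (P Q : pred I) (F : I -> nat) :
  odd (\sum_(i | P i (+) Q i) F i) =
  odd (\sum_(i | P i) F i) (+) odd (\sum_(i | Q i) F i).
Proof.
have E (R : pred I) : odd (\sum_(i | R i) F i) = \big[addb/false]_i (R i && odd (F i)).
  rewrite big_mkcond (big_morph odd oddD (erefl : odd 0 = false)).
  by apply: eq_bigr => i _; case: (R i).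
rewrite !E -big_split /=; apply: eq_bigr => i _.
by case: (P i); case: (Q i); case: (odd _).
Qed.

(** Pigeonhole: two subsets of 'I_n have the same m parities, and the parities of
    their symmetric difference vanish. *)
Lemma parity_dependence n m (F : 'I_m -> 'I_n -> nat) : m < n ->
  exists2 D : {set 'I_n}, D != set0 & forall j, ~~ odd (\sum_(i in D) F j i).
Proof.
move=> mn; pose f (A : {ffun 'I_n -> bool}) := [ffun j => odd (\sum_(i | A i) F j i)].
have /injectivePn[A [B AB fAB]] : ~~ injectiveb f.
  apply/negP => /injectiveP/leq_card.
  by rewrite !card_ffun card_bool !card_ord leq_exp2l // leqNgt mn.
exists [set i | A i (+) B i].
  apply: contraNneq AB => D0; apply/eqP/ffunP => i; apply/eqP.
  by have := in_set0 i; rewrite -D0 inE; case: (A i); case: (B i).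
move=> j; rewrite (eq_bigl (fun i => A i (+) B i)); last by move=> i; rewrite inE.
have := congr1 (fun g : {ffun 'I_m -> bool} => g j) fAB; rewrite !ffunE odd_sum_xor => ->.
by rewrite addbb.
Qed.

(** Primes above k occur in d - 2 i to an even power, since 2 i divides the
    exponent.  There remain pi(k) parities, and one more for the number of
    terms, against pi(k) + 2 even shifts. *)
Lemma even_square_product k d : 14 <= k -> rough_powers k d ->
  exists h (A : seq nat) y, [/\ size A = 2 * h, 0 < h, 2 * h <= prime_pi k + 2, uniq A &
     {in A, forall a, a <= k} /\ \prod_(a <- A) (d - a) = y ^ 2].
Proof.
move=> k14 [kd bad]; have pik := prime_pi_le_half k14.
pose n := (prime_pi k).+2; pose m := (prime_pi k).+1.
pose ps := primes_upto k.
have pos (i : 'I_n) : 0 < d - 2 * i.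
  by rewrite subn_gt0; have := ltn_ord i; rewrite /n; lia.
(* The last parity, of the constant 1, is that of the number of terms. *)
pose F (j : 'I_m) (i : 'I_n) :=
  if (j : nat) < prime_pi k then logn (nth 0 ps j) (d - 2 * i) else 1.
have [D D0 DF] := @parity_dependence n m F (leqnn _).
have evD : ~~ odd #|D|.
  have := DF ord_max; rewrite (eq_bigr (fun=> 1)) ?sum1_card // => i _.
  by rewrite /F ltnn.
pose A := [seq 2 * val i | i <- enum D].
have [| |y prody] := @perfect_power 2 (\prod_(i in D) (d - 2 * i)).
- by rewrite prodn_gt0.
- move=> q pq; rewrite logn_prod //.
  have [qk|kq] := leqP q k.
    have qps : q \in ps by rewrite mem_primes_upto pq.
    have jm : index q ps < m by rewrite ltnS ltnW // index_mem.
    have := DF (Ordinal jm); rewrite dvdn2; congr (~~ odd _).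
    by apply: eq_bigr => i _; rewrite /F /= index_mem qps nth_index.
  apply: dvdn_sum => i _; apply: (@dvdn_trans (2 * i)); first exact: dvdn_mulr.
  by apply: bad => //; have := ltn_ord i; rewrite /n; lia.
exists (#|D|./2), A, y; split.
- by rewrite size_map -cardE mul2n even_halfK.
- by rewrite half_gt0; move: evD D0; rewrite -card_gt0; case: #|D| => [|[|]].
- rewrite mul2n even_halfK // addn2; have := max_card (mem D).
  by rewrite card_ord.
- by rewrite map_inj_uniq ?enum_uniq // => i j /eqP; rewrite eqn_mul2l /= => /eqP/val_inj.
split; last by rewrite big_map big_enum_cond /= -prody; apply: eq_bigl => i; rewrite andbT.
by move=> _ /mapP[i _ ->] /=; have := ltn_ord i; rewrite /n; lia.
Qed.

Lemma rough_powers_le k d : 14 <= k -> rough_powers k d ->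
  d <= k ^ (4 * prime_pi k + 11).
Proof.
move=> k14 bad; have [h [A [y [sA h0 hpi uA [Ak prody]]]]] := even_square_product k14 bad.
have kd : k <= d by case: bad; lia.
have k0 : 0 < k by lia.
apply: leq_trans (square_product_bound sA h0 k0 uA Ak kd prody) _.
have hk : h <= k by have := prime_pi_le_half k14; lia.
apply: (@leq_trans (k ^ 3 * (k ^ 4) ^ (2 * h))); last first.
  by rewrite -expnM -expnD leq_exp2l; lia.
apply: leq_mul; first by rewrite !expnS expn0; nia.
have h2 : 8 * h ^ 2 * k <= k ^ 4.
  rewrite (_ : k ^ 4 = k * k ^ 2 * k); last by rewrite -expnS -expnSr.
  by rewrite leq_mul2r leq_mul ?orbT // ?leq_sqr //; lia.
by rewrite leq_exp2r // muln_gt0.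
Qed.

(** * Primes and binomial coefficients *)

Lemma logn_fact_widen p n N : prime p -> n <= N ->
  logn p n`! = \sum_(1 <= i < N.+1) n %/ p ^ i.
Proof.
move=> pp nN; rewrite logn_fact // [RHS](@big_cat_nat _ _ _ n.+1) //=.
rewrite [X in _ = _ + X]big_nat_cond [X in _ = _ + X]big1 ?addn0 //.
move=> i /andP[/andP[ni _] _].
rewrite divn_small // (leq_trans ni) // ltnW //.
by rewrite (leq_trans (ltn_expl i (prime_gt1 pp))).
Qed.

Lemma logn_bin p n m : prime p -> m <= n ->
  logn p 'C(n, m) = \sum_(1 <= i < n.+1) (n %/ p ^ i - (m %/ p ^ i + (n - m) %/ p ^ i)).
Proof.
move=> pp mn; rewrite sumnB => [|i _]; last first.
  by rewrite -{2}(subnKC mn) divnD ?expn_gt0 ?prime_gt0 // leq_addr.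
rewrite big_split /= -!logn_fact_widen ?leq_subr // -(bin_fact mn).
by rewrite !lognM ?muln_gt0 ?bin_gt0 ?fact_gt0 // addnK.
Qed.

Lemma divnB_le1 n m q : m <= n -> n %/ q - (m %/ q + (n - m) %/ q) <= (q <= n).
Proof.
move=> mn; case: (posnP q) => [->|q0]; first by rewrite divn0.
case: (leqP q n) => [_|nq]; last by rewrite divn_small.
by rewrite leq_subLR -{1}(subnKC mn) divnD // leq_add2l leq_b1.
Qed.

(** In Legendre's formula each power p^i <= n contributes at most 1. *)
Lemma pfactor_bin_le p n m : prime p -> m <= n -> 0 < n -> p ^ logn p 'C(n, m) <= n.
Proof.
move=> pp mn n0; have p1 := prime_gt1 pp.
apply: leq_trans (trunc_logP p1 n0); rewrite leq_exp2l // logn_bin //.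
apply: (@leq_trans (\sum_(1 <= i < n.+1) (i <= trunc_log p n))).
  apply: leq_sum => i _; apply: leq_trans (divnB_le1 _ mn) _.
  by case: (leqP (p ^ i) n) => // pin; rewrite trunc_log_max.
have tn : trunc_log p n <= n by rewrite (leq_trans (ltnW (ltn_expl _ p1))) // trunc_logP.
rewrite (@big_cat_nat _ _ _ (trunc_log p n).+1) //=.
rewrite [X in _ + X]big_nat_cond [X in _ + X]big1 ?addn0; last first.
  by move=> i /andP[/andP[h _] _]; rewrite leqNgt h.
apply: (@leq_trans (\sum_(1 <= i < (trunc_log p n).+1) 1)).
  by apply: leq_sum => i _; apply: leq_b1.
by rewrite sum_nat_const_nat muln1 subSS subn0.
Qed.

(** Only i = 1 contributes, and there the floors of n/p, m/p and (n - m)/p are 2,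
    1 and at least 1. *)
Lemma logn_bin_eq0 p n m : prime p -> 2 * m <= n -> p <= m -> n < 3 * p ->
  n < p ^ 2 -> logn p 'C(n, m) = 0.
Proof.
move=> pp mn pm n3p np2; have p0 := prime_gt0 pp.
have mn' : m <= n by lia.
rewrite logn_bin // big_nat_cond big1 // => i /andP[/andP[i1 _] _].
case: i i1 => // -[_|i _].
  have a : n %/ p <= 2 by rewrite -ltnS ltn_divLR.
  have b : 1 <= m %/ p by rewrite divn_gt0.
  have c : 1 <= (n - m) %/ p by rewrite divn_gt0 //; lia.
  by rewrite expn1; lia.
apply/eqP; rewrite -leqn0; apply: leq_trans (divnB_le1 _ mn') _.
by rewrite [p ^ _ <= n]leqNgt (leq_trans np2) // leq_exp2l // prime_gt1.
Qed.

Definition primorial n := \prod_(p <- primes_upto n) p.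

Lemma prod_primes_dvd (s : seq nat) n : uniq s -> all prime s ->
  all (fun p => p %| n) s -> \prod_(p <- s) p %| n.
Proof.
elim: s => [|p s IH] /=; first by rewrite big_nil.
move=> /andP[ps us] /andP[pp prs] /andP[pn sn]; rewrite big_cons Gauss_dvd ?pn ?IH //.
rewrite big_seq; elim/big_ind: _ => [|x y cx cy|q qs]; first exact: coprimen1.
  by rewrite coprimeMr cx.
rewrite prime_coprime // (dvdn_prime2 pp (allP prs q qs)).
by apply: contraNneq ps => ->.
Qed.

Lemma primorialS n : primorial n.+1 = (if prime n.+1 then n.+1 else 1) * primorial n.
Proof.
rewrite /primorial primes_uptoS; case: prime; last by rewrite mul1n.
by rewrite big_rcons mulnC.
Qed.

Lemma central_bin_succ m :
  m.+1 * 'C(2 * m.+1, m.+1) = 2 * (2 * m + 1) * 'C(2 * m, m).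
Proof.
have e1 := mul_bin_diag (2 * m.+1) m; have e2 := mul_bin_down (2 * m + 1) m.
rewrite addn1 /= (_ : (2 * m).+1 - m = m.+1) in e2; last by lia.
rewrite (_ : (2 * m.+1).-1 = (2 * m).+1) in e1; last by lia.
by rewrite -e1 -!mulnA -e2 addn1.
Qed.

Lemma central_bin_le m : 0 < m -> 2 * 'C(2 * m, m) <= 4 ^ m.
Proof.
elim: m => // [[|m]] // /(_ isT) IH _.
rewrite -(leq_pmul2l (ltn0Sn m.+1)) mulnCA central_bin_succ expnS; nia.
Qed.

Lemma central_bin_ge m : 4 ^ m <= (2 * m + 1) * 'C(2 * m, m).
Proof.
elim: m => // m IH.
have := central_bin_succ m; rewrite expnS; nia.
Qed.

Lemma prime_dvd_fact p n : prime p -> p %| n`! -> p <= n.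
Proof.
move=> pp; elim: n => [|n IH]; first by rewrite dvdn1 => /eqP e; rewrite e in pp.
rewrite factS Euclid_dvdM // => /orP[/dvdn_leq->//|/IH/leq_trans->//].
Qed.

(** For n = 2 m + 1 the primes between m + 2 and n divide C(n, m), which is at
    most 4^m. *)
Lemma primorial_le n : primorial n <= 4 ^ n.
Proof.
elim/ltn_ind: n => n IH.
have [n2|n2] := leqP n 2.
  by case: n n2 {IH} => [|[|[|]]] //; rewrite /primorial unlock.
have step : ~~ prime n -> primorial n <= 4 ^ n.
  case: n n2 IH => // n _ IH pn; rewrite primorialS (negbTE pn) mul1n.
  by apply: leq_trans (IH n _) _; rewrite // leq_exp2l.
have [on|en] := boolP (odd n); last by apply: step; apply: even_not_prime.
pose m := n./2; have nE : n = m + m.+1 by rewrite /m; lia.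
have m1 : m.+1 < n by lia.
have split_ps : primes_upto n = primes_upto m.+1 ++ [seq p <- iota m.+2 m | prime p].
  by rewrite /primes_upto -filter_cat (_ : n.+1 = m.+2 + m) ?iotaD //; lia.
rewrite /primorial split_ps big_cat /=.
have b0 : 0 < 'C(n, m) by rewrite bin_gt0; lia.
have up : \prod_(p <- [seq p <- iota m.+2 m | prime p]) p <= 4 ^ m.
  apply: (@leq_trans 'C(n, m)).
    apply: dvdn_leq => //; apply: prod_primes_dvd.
    - by rewrite filter_uniq ?iota_uniq.
    - exact: filter_all.
    apply/allP => p; rewrite mem_filter mem_iota => /andP[pp /andP[mp pm]].
    have : p %| 'C(n, m) * (m`! * (n - m)`!).
      by rewrite bin_fact; [apply: dvdn_fact; rewrite prime_gt0 //; lia | lia].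
    rewrite !Euclid_dvdM // => /or3P[//| |].
      by move=> /(prime_dvd_fact pp); lia.
    by move=> /(prime_dvd_fact pp); lia.
  have := central_bin_le (ltn0Sn m); rewrite (_ : 2 * m.+1 = n.+1) ?binS; last by lia.
  have -> : 'C(n, m.+1) = 'C(n, m) by rewrite -bin_sub; [congr ('C(_, _))|]; lia.
  by rewrite expnS; lia.
rewrite nE expnD mulnC leq_mul //; exact: IH.
Qed.

Lemma prime_pi_le n : prime_pi n <= n.
Proof.
elim: n => // n IH; rewrite prime_piS -addn1 leq_add //; exact: leq_b1.
Qed.

Lemma primorial_ge m n : 0 < m -> m ^ prime_pi n <= m ^ m * primorial n.
Proof.
move=> m0; elim: n => [|n IH].
  by rewrite /primorial big_nil muln1 expn0 expn_gt0 m0.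
rewrite primorialS prime_piS; case: (boolP (prime n.+1)) => pn; last by rewrite addn0 mul1n.
rewrite addn1 expnS.
have [mn|nm] := leqP m n.+1; first by rewrite mulnCA leq_mul.
rewrite -expnS; apply: (@leq_trans (m ^ m)).
  by rewrite leq_pexp2l //; have := prime_pi_le n; lia.
rewrite leq_pmulr // muln_gt0 /= /primorial big_seq prodn_cond_gt0 // => p.
by rewrite mem_primes_upto => /andP[/prime_gt0].
Qed.

(** Primes above 4^c have product at least (4^c)^(pi(n) - 4^c), and at most 4^n. *)
Lemma prime_pi_linear c n : c * prime_pi n <= n + c * 4 ^ c.
Proof.
have := primorial_ge n (m := 4 ^ c); rewrite expn_gt0 => /(_ isT) h.
have {h} := leq_trans h (leq_mul (leqnn _) (primorial_le n)).
by rewrite -!expnM -expnD leq_exp2l // addnC.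
Qed.

(** * Large k *)

(** The numbers n`_(above k) and n`_(above k)^' are the k-rough and the k-smooth
    part of n. *)
Definition above k : nat_pred := [pred p | k < p].

Lemma smooth_partE k n :
  n`_(above k)^' = \prod_(p <- primes_upto k) p ^ logn p n.
Proof.
rewrite (widen_partn _ (leq_addr k n)) (@big_cat_nat _ _ _ k.+1) //=; last first.
  by rewrite ltnS leq_addl.
rewrite [X in _ * X]big_nat_cond [X in _ * X]big1 ?muln1; last first.
  by move=> p /andP[/andP[kp _]]; rewrite !inE kp.
rewrite /primes_upto big_filter -[iota 0 k.+1]/(index_iota 0 k.+1).
rewrite big_nat_cond [RHS]big_nat_cond big_mkcond [RHS]big_mkcond /=.
apply: eq_bigr => p _; rewrite !inE -leqNgt ltnS; case: leqP => //= _.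
by case: ifP => // np; rewrite lognE np.
Qed.

(** If i >= a, then d - i has no prime factor q > k, since q^i would divide it
    and exceed d.  Hence only the first a factors of d (d-1) ... (d-k+1) have
    a rough part. *)
Lemma rough_part_le k d a : rough_powers k d -> d < k.+1 ^ a ->
  'C(d, k)`_(above k) <= d ^ a.
Proof.
move=> [kd bad] da; have d0 : 0 < d by lia.
have b0 : 0 < 'C(d, k) by rewrite bin_gt0; lia.
apply: (@leq_trans ('C(d, k) * k`!)`_(above k)).
  by rewrite partnM ?fact_gt0 // leq_pmulr ?part_gt0.
rewrite bin_ffact ffact_prod.
have part_prod m : m <= k ->
    (\prod_(i < m) (d - i))`_(above k) = \prod_(i < m) (d - i)`_(above k).
  elim: m => [|m IH] mk; first by rewrite !big_ord0 partn1.
  rewrite !big_ord_recr /= partnM ?IH //; [exact: ltnW | | by rewrite subn_gt0; lia].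
  by rewrite prodn_gt0 // => i; rewrite subn_gt0; have := ltn_ord i; lia.
rewrite part_prod //.
apply: (@leq_trans (\prod_(i < k) (if i < a then d else 1))).
  apply: leq_prod => i _; have ik := ltn_ord i.
  have di0 : 0 < d - i by rewrite subn_gt0; lia.
  case: ifP => ia.
    by rewrite (leq_trans (dvdn_leq di0 (dvdn_part _ _))) ?leq_subr.
  rewrite part_p'nat // /pnat di0; apply/allP => p; rewrite mem_primes.
  case/and3P => pp _ pdi; rewrite !inE; apply/negP => kp.
  have v0 : 0 < logn p (d - i) by rewrite logn_gt0 mem_primes pp di0.
  have iv := dvdn_leq v0 (bad i p (ltnW ik) pp kp).
  have : p ^ a <= d - i.
    apply: dvdn_leq => //; rewrite pfactor_dvdn //; lia.
  rewrite leqNgt (leq_trans _ (_ : k.+1 ^ a <= p ^ a)) //.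
    by apply: leq_ltn_trans da; rewrite leq_subr.
  by case: (a) => // b; rewrite leq_exp2r.
rewrite -(big_mkord predT (fun i => if i < a then d else 1)).
have := leq_total a k => /orP[ak|ka].
  rewrite (@big_cat_nat _ _ _ a) //= [X in _ * X]big_nat_cond [X in _ * X]big1 ?muln1.
    rewrite big_nat_cond (eq_bigr (fun=> d)) -?big_nat_cond ?prod_nat_const_nat ?subn0 //.
    by move=> i /andP[/andP[_ ->]].
  by move=> i /andP[/andP[ai _] _]; rewrite ltnNge ai.
rewrite big_nat_cond (eq_bigr (fun=> d)).
  by rewrite -big_nat_cond prod_nat_const_nat subn0 leq_pexp2l.
by move=> i /andP[/andP[_ ik] _]; rewrite (leq_trans ik ka).
Qed.

Lemma bin_le_far k d a : rough_powers k d -> d < k.+1 ^ a ->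
  'C(d, k) <= d ^ (prime_pi k + a).
Proof.
move=> bad da; have [kd _] := bad.
have b0 : 0 < 'C(d, k) by rewrite bin_gt0; lia.
rewrite -(partnC (above k) b0) mulnC expnD leq_mul ?rough_part_le // smooth_partE.
apply: (@leq_trans (\prod_(p <- primes_upto k) d)).
  rewrite big_seq [leqRHS]big_seq; apply: leq_prod => p.
  by rewrite mem_primes_upto => /andP[pp _]; apply: pfactor_bin_le; lia.
rewrite big_const_seq count_predT -/(prime_pi k).
by elim: (prime_pi k) => //= n IH; rewrite expnS leq_mul.
Qed.

Lemma expn_le_bin d k : k <= d -> d ^ k <= k ^ k * 'C(d, k).
Proof.
move=> kd; rewrite -(leq_pmul2r (fact_gt0 k)) -mulnA bin_ffact ffact_prod.
have -> : k`! = \prod_(i < k) (k - i) by rewrite -ffact_prod ffactnn.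
have c n : n ^ k = \prod_(i < k) n by rewrite prod_nat_const card_ord.
rewrite (c d) (c k) -!big_split /=; apply: leq_prod => i _.
by rewrite !mulnBr mulnC leq_sub2l // leq_mul2r kd orbT.
Qed.

Lemma filter_primes_upto t k : t <= k ->
  [seq p <- primes_upto k | p <= t] = primes_upto t.
Proof.
move=> tk; rewrite -filter_predI /primes_upto -(subnKC tk) -addSn iotaD filter_cat add0n.
have -> : [seq p <- iota t.+1 (k - t) | (predI (leq^~ t) prime) p] = [::].
  apply/eqP; rewrite -[_ == _]negbK -has_filter; apply/hasPn => p.
  by rewrite mem_iota /= => /andP[tp _]; rewrite leqNgt tp.
rewrite cats0; apply: eq_in_filter => p; rewrite mem_iota /= => pt.
by rewrite -ltnS pt.
Qed.

(** Primes at most s contribute at most d each.  Primes above s occur at most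
    once, and those between d/3 and k do not occur; the product of the
    remaining ones is at most 4^(min(k, d/3)). *)
Lemma bin_le_near k d s : rough_powers k d -> d < k.+1 ^ 2 -> s <= k -> d < s.+1 ^ 2 ->
  'C(d, k) <= d ^ (s + 2) * 4 ^ minn k (d %/ 3).
Proof.
move=> bad dk2 sk ds2; have [kd _] := bad; have d0 : 0 < d by lia.
have b0 : 0 < 'C(d, k) by rewrite bin_gt0; lia.
set t := minn _ _; have tk : t <= k by rewrite geq_minl.
rewrite -(partnC (above k) b0) mulnC expnD mulnAC leq_mul ?rough_part_le // smooth_partE.
apply: (@leq_trans (\prod_(p <- primes_upto k)
    ((if p <= s then d else 1) * (if p <= t then p else 1)))).
  rewrite big_seq [leqRHS]big_seq; apply: leq_prod => p.
  rewrite mem_primes_upto => /andP[pp pk]; have p0 := prime_gt0 pp.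
  have vd : p ^ logn p 'C(d, k) <= d by apply: pfactor_bin_le; lia.
  case: (leqP p s) => [_|sp].
    by rewrite (leq_trans vd) // leq_pmulr //; case: ifP.
  have dp2 : d < p ^ 2 by rewrite (leq_trans ds2) // leq_exp2r.
  rewrite mul1n; case: (leqP p t) => [_|tp].
    rewrite -[leqRHS]expn1 leq_exp2l ?prime_gt1 //.
    by rewrite -ltnS -(ltn_exp2l _ _ (prime_gt1 pp)) (leq_ltn_trans vd).
  rewrite (@logn_bin_eq0 p d k) //; first by lia.
  move: tp; rewrite /t gtn_min ltnNge pk /=.
  by rewrite ltn_divLR // mulnC.
rewrite big_split /= leq_mul //.
  rewrite -big_mkcond -big_filter filter_primes_upto //= big_const_seq count_predT.
  apply: (@leq_trans (d ^ prime_pi s)); last by rewrite leq_pexp2l // prime_pi_le.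
  by rewrite -/(prime_pi s); elim: (prime_pi s) => //= n IH; rewrite expnS leq_mul.
by rewrite -big_mkcond -big_filter filter_primes_upto //= primorial_le.
Qed.

(** Each step multiplies the binomial coefficient by
    (2 k + j + 1) / (k + j + 1) >= 3/2. *)
Lemma bin_growth k j : j <= k -> 3 ^ j * 'C(2 * k, k) <= 2 ^ j * 'C(2 * k + j, k).
Proof.
elim: j => [|j IH] jk; first by rewrite addn0.
have {IH} IH := IH (ltnW jk).
have := mul_bin_down (2 * k + j).+1 k; rewrite /= addnS (_ : _ - k = k + j.+1); last by lia.
move=> e; rewrite -(leq_pmul2l (ltn0Sn (k + j))).
rewrite !expnS -addnS mulnA [X in X * _ <= _]mulnCA -!mulnA [leqRHS]mulnCA.
rewrite [X in _ <= _ * X]mulnCA -e.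
move: IH; move: (3 ^ j * _) => a.
rewrite [X in _ -> _ <= _ * X]mulnCA; move: (2 ^ j * _) => b; nia.
Qed.

(** From C(2k, k) >= 4^k / (2k+1) and [bin_growth], the coefficient C(d, k) is at
    least 6^k / (2k+1) for d >= 3k, against an upper bound with main factor
    4^k.  For d = 2k + j with j <= k the lower bound is (3/2)^j 4^k / (2k+1)
    and the main factor is 4^(d/3); after cubing, the worst case is j = k. *)
Lemma expn3_le_near k d s : rough_powers k d -> d < k.+1 ^ 2 -> s <= k ->
  d < s.+1 ^ 2 -> 3 ^ k <= d ^ (3 * s + 9).
Proof.
move=> bad dk2 sk ds2; have [kd _] := bad.
have le := bin_le_near bad dk2 sk ds2.
have ge := central_bin_ge k.
set X := (2 * k + 1) * d ^ (s + 2).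
have Xle : X ^ 3 <= d ^ (3 * s + 9).
  rewrite (_ : 3 * s + 9 = (s + 2).+1 * 3); last by lia.
  by rewrite expnM leq_exp2r // /X expnS leq_mul //; lia.
apply: leq_trans Xle.
have cube a b : a <= b -> a ^ 3 <= b ^ 3 by rewrite leq_exp2r.
suff h : 27 ^ k <= X ^ 3 * 8 ^ k.
  rewrite -(@leq_pmul2r (8 ^ k)) ?expn_gt0 // (leq_trans _ h) // -expnMn.
  by case: (k) => // n; rewrite leq_exp2r.
have [kj|jk] := leqP (3 * k) d.
  have : 4 ^ k * 3 ^ k <= X * 2 ^ k * 4 ^ k.
    have g := bin_growth (leqnn k); rewrite (_ : 2 * k + k = 3 * k) in g; last by lia.
    have m : 'C(3 * k, k) <= d ^ (s + 2) * 4 ^ k.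
      rewrite (leq_trans (leq_bin2l k kj)) // (leq_trans le) // leq_mul2l.
      by rewrite leq_exp2l // geq_minl orbT.
    apply: (@leq_trans ((2 * k + 1) * (2 ^ k * 'C(3 * k, k)))).
      rewrite (leq_trans (leq_mul ge (leqnn _))) // -mulnA leq_mul2l.
      by rewrite [_ * 3 ^ _]mulnC g orbT.
    rewrite /X -!mulnA leq_mul2l; apply/orP; right.
    by rewrite mulnCA leq_mul2l m orbT.
  rewrite [X in X <= _]mulnC leq_pmul2r ?expn_gt0 // => /cube.
  by rewrite expnMn -!expnM ![k * 3]mulnC !expnM.
pose j := d - 2 * k; have dE : d = 2 * k + j by rewrite /j; lia.
have jk' : j <= k by rewrite /j; lia.
have {jk} : 4 ^ k * 3 ^ j <= X * 2 ^ j * 4 ^ (d %/ 3).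
  have g := bin_growth jk'; rewrite -dE in g.
  have m : 'C(d, k) <= d ^ (s + 2) * 4 ^ (d %/ 3).
    by rewrite (leq_trans le) // leq_mul2l leq_exp2l // geq_minr orbT.
  apply: (@leq_trans ((2 * k + 1) * (2 ^ j * 'C(d, k)))).
    rewrite (leq_trans (leq_mul ge (leqnn _))) // -mulnA leq_mul2l.
    by rewrite [_ * 3 ^ _]mulnC g orbT.
  rewrite /X -!mulnA leq_mul2l; apply/orP; right.
  by rewrite mulnCA leq_mul2l m orbT.
clearbody X; move=> /cube; rewrite !expnMn -!expnM.
have -> : 4 ^ (k * 3) = 64 ^ k by rewrite mulnC expnM.
have -> : 3 ^ (j * 3) = 27 ^ j by rewrite mulnC expnM.
have -> : 2 ^ (j * 3) = 8 ^ j by rewrite mulnC expnM.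
move=> h.
have {}h : 64 ^ k * 27 ^ j <= X ^ 3 * 16 ^ k * 32 ^ j.
  apply: leq_trans h _.
  apply: (@leq_trans (X ^ 3 * 8 ^ j * 4 ^ d)).
    by rewrite leq_mul2l leq_exp2l // leq_divM orbT.
  have -> : 4 ^ d = 16 ^ k * 4 ^ j by rewrite dE expnD expnM.
  have -> : 32 ^ j = 8 ^ j * 4 ^ j by rewrite -expnMn.
  by rewrite mulnACA.
rewrite -(@leq_pmul2l (64 ^ k)) ?expn_gt0 // -[in 27 ^ k](subnKC jk') expnD mulnA.
apply: leq_trans (leq_mul h (leqnn _)) _.
have -> : 64 ^ k * (X ^ 3 * 8 ^ k) = X ^ 3 * 16 ^ k * 32 ^ k.
  by rewrite mulnCA -expnMn -[64 * 8]/(16 * 32) expnMn mulnA.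
rewrite -mulnA leq_mul // -[in 32 ^ k](subnKC jk') expnD leq_mul //.
by case: (k - j) => // n; rewrite leq_exp2r.
Qed.

Lemma floor_root m d : 0 < m -> exists s, s ^ m <= d < s.+1 ^ m.
Proof.
move=> m0; elim: d => [|d [s /andP[sd ds]]]; first by exists 0; rewrite exp0n // exp1n.
have [ds1|sd1] := ltnP d.+1 (s.+1 ^ m).
  by exists s; rewrite ds1 (leq_trans sd).
by exists s.+1; rewrite sd1 (leq_ltn_trans ds) // ltn_exp2r.
Qed.

(** With 2^u <= v + 1 < 2^(u+1), it suffices that c (u + 1) < 2^u. *)
Lemma pow_lt_exp2 c : {V | forall v, V <= v -> v.+1 ^ c < 2 ^ v}.
Proof.
exists (2 ^ (2 * c + 1)) => v Vv.
have /andP[u1 u2] := trunc_log_bounds (isT : 1 < 2) (ltn0Sn v).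
set u := trunc_log 2 v.+1 in u1 u2.
have cu : 2 * c < u.
  have : 2 ^ (2 * c + 1) < 2 ^ u.+1 by apply: leq_ltn_trans Vv (ltn_trans (ltnSn v) u2).
  by rewrite ltn_exp2l //; lia.
have cx := ltn_expl c (isT : 1 < 2).
have lin n : 2 * c < n -> c * n.+1 < 2 ^ n.
  elim: n => // n IH; rewrite ltnS leq_eqVlt => /predU1P[<-|cn].
    by rewrite expnS mulnC mul2n -addnn expnD; nia.
  have := IH cn; have : 2 ^ c <= 2 ^ n by rewrite leq_exp2l //; lia.
  by rewrite expnS; lia.
case: (posnP c) => [->|c0]; first by rewrite expn0; have := ltn_expl v (isT : 1 < 2); lia.
apply: (@leq_trans ((2 ^ u.+1) ^ c)); first by rewrite ltn_exp2r.
rewrite -expnM leq_exp2l // mulnC -ltnS (leq_trans _ u1) //; exact: lin.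
Qed.

(** Let v be the integral fourth root of k.  Then s < (v+1)^3, so the left side is
    at most (v+1)^(72 (v+1)^3), while the right side is at least 2^(v^4). *)
Lemma sparse_powers :
  {K | forall k s, K <= k -> s ^ 4 < k ^ 3 -> s.+1 ^ (6 * s + 18) < 3 ^ k}.
Proof.
have [V VP] := pow_lt_exp2 576; exists (V.+2 ^ 4) => k s Kk sk.
have [v /andP[vk kv]] := floor_root k (isT : 0 < 4).
have Vv : V.+2 < v.+1 by rewrite -(@ltn_exp2r _ _ 4) // (leq_ltn_trans Kk).
have sv : s < v.+1 ^ 3.
  rewrite -(@ltn_exp2r _ _ 4) // (leq_trans sk) // -expnM (expnM _ 4 3).
  by rewrite leq_exp2r // ltnW.
have v0 : 0 < v by lia.
apply: (@leq_trans (2 ^ k)); last by case: (k) => // n; rewrite leq_exp2r.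
apply: (@leq_trans (2 ^ (v ^ 4))); last by rewrite leq_exp2l.
apply: (@leq_ltn_trans ((v.+1 ^ 3) ^ (24 * v.+1 ^ 3))).
  apply: (@leq_trans ((v.+1 ^ 3) ^ (6 * s + 18))); first by rewrite leq_exp2r //; lia.
  rewrite leq_exp2l; last by rewrite -[1](exp1n 3) ltn_exp2r.
  by lia.
apply: (@leq_ltn_trans ((v.+1 ^ 576) ^ (v ^ 3))).
  rewrite -!expnM leq_exp2l //.
  have : v.+1 ^ 3 <= (2 * v) ^ 3 by rewrite leq_exp2r //; lia.
  by rewrite expnMn; lia.
rewrite [v ^ 4]expnS expnM ltn_exp2r ?expn_gt0 ?v0 //; apply: VP; lia.
Qed.

(** For d^2 >= k^3 one has (d/k)^3 >= d, so that d^k <= C(d, k)^3; by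
    [rough_powers_le] and [bin_le_far] this gives k <= 15 pi(k) + 33.  For
    d^2 < k^3 and s the integral square root of d, [expn3_le_near]
    contradicts [sparse_powers]. *)
Lemma rough_powers_large : {K | forall k d, K <= k -> ~ rough_powers k d}.
Proof.
have [K KP] := sparse_powers.
exists (maxn K (maxn 14 (240 * 4 ^ 16 + 529))) => k d.
rewrite !geq_max => /and3P[Kk k14 kbig] bad; have [kd _] := bad.
have d1 : 1 < d by lia.
have [far|near] := leqP (k ^ 3) (d ^ 2).
  pose a := 4 * prime_pi k + 11.
  have da : d < k.+1 ^ a.
    apply: leq_ltn_trans (rough_powers_le k14 bad) _; rewrite ltn_exp2r /a //; lia.
  have b := bin_le_far bad da; have e := @expn_le_bin d k ltac:(lia).
  have : d ^ k <= d ^ (3 * (prime_pi k + a)).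
    rewrite -(@leq_pmul2l ((d ^ 2) ^ k)) ?expn_gt0 ?(ltnW d1) //.
    apply: (@leq_trans ((d ^ k) ^ 3)).
      by rewrite -!expnM -expnD leq_exp2l //; lia.
    apply: (@leq_trans ((k ^ k * 'C(d, k)) ^ 3)); first by rewrite leq_exp2r.
    rewrite expnMn leq_mul //.
      by rewrite -expnM mulnC expnM; case: (k) far => // n far; rewrite leq_exp2r.
    by rewrite mulnC expnM leq_exp2r.
  rewrite leq_exp2l // /a; have := prime_pi_linear 16 k; lia.
have [s /andP[sd ds]] := floor_root d (isT : 0 < 2).
have s4 : s ^ 4 < k ^ 3.
  by apply: leq_ltn_trans near; rewrite (expnM s 2 2) leq_exp2r.
have k0 : 0 < k by lia.
have sk : s <= k.
  rewrite leqNgt; apply/negP => ks; have : k ^ 3 <= s ^ 4.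
    apply: (@leq_trans (k ^ 4)); first by rewrite leq_pexp2l.
    by rewrite leq_exp2r // ltnW.
  by rewrite leqNgt s4.
have dk2 : d < k.+1 ^ 2.
  rewrite -(@ltn_exp2r _ _ 2) // -expnM (ltn_trans near) //.
  by apply: (@leq_ltn_trans (k ^ 4)); rewrite ?leq_pexp2l ?ltn_exp2r.
have := expn3_le_near bad dk2 sk ds; rewrite leqNgt => /negP; apply.
apply: leq_ltn_trans (KP k s Kk s4).
apply: (@leq_trans ((s.+1 ^ 2) ^ (3 * s + 9))).
  by rewrite leq_exp2r ?(ltnW ds) //; lia.
by rewrite -expnM leq_exp2l //; lia.
Qed.

(** * Finiteness *)

Lemma rough_powers_bound k : 0 < k ->
  {B | forall d, 1 < d -> rough_powers k d -> d <= B}.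
Proof.
have weaken n (H : {B | forall d, rough_powers n d -> d <= B}) :
    {B | forall d, 1 < d -> rough_powers n d -> d <= B}.
  by have [B HB] := H; exists B => d _; apply: HB.
have descend n : ~~ prime n.+1 ->
    {B | forall d, 1 < d -> rough_powers n d -> d <= B} ->
    {B | forall d, 1 < d -> rough_powers n.+1 d -> d <= B}.
  by move=> npn [B HB]; exists B => d d1 /(rough_powersS npn); apply: HB.
have [k14 _|k14] := leqP 14 k.
  by exists (k ^ (4 * prime_pi k + 11)) => d _; apply: rough_powers_le.
move: k14; do 14?[case: k => [|k]] => // _ _.
- exists 0 => d d1 bad.
  have := rough_powers_smooth bad (pdiv_prime d1) (pdiv_dvd d).
  by rewrite leqNgt prime_gt1 ?pdiv_prime.
- exact/weaken/bounded_2.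
- exact/weaken/bounded_3.
- exact/descend/weaken/bounded_3.
- exact/weaken/bounded_5.
- exact/descend/weaken/bounded_5.
- exact/weaken/bounded_7.
- exact/descend/weaken/bounded_7.
- exact/descend/descend/weaken/bounded_7.
- exact/descend/descend/descend/weaken/bounded_7.
- exact/weaken/bounded_11.
- exact/descend/weaken/bounded_11.
- exact/weaken/bounded_13.
Qed.

(** The bounds are produced as data, not only asserted to exist, so that the
    exceptional pairs are computable. *)
Lemma rough_powers_bounded :
  {B | forall k d, 0 < k -> 1 < d -> rough_powers k d -> d <= B}.
Proof.
have [K large] := rough_powers_large.
have [B HB] : {B | forall k d, k < K -> 0 < k -> 1 < d -> rough_powers k d -> d <= B}.
  elim: K {large} => [|K [B HB]]; first by exists 0.
  have [K0|K0] := posnP K; first by exists B => k d; rewrite K0; lia.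
  have [C HC] := rough_powers_bound K0.
  exists (maxn B C) => k d; rewrite ltnS leq_eqVlt leq_max => /predU1P[->|kK] k0 d1 bad.
    by rewrite HC ?orbT.
  by rewrite (HB k).
exists B => k d k0 d1 bad; have [Kk|kK] := leqP K k; first by have := large k d Kk.
exact: (HB k).
Qed.

Definition has_idf d k : bool :=
  has (fun p => [&& prime p, k < p &
    has (fun r => (p %| d - r) && ~~ (r %| logn p (d - r))) (iota 0 k.+1)])
    (iota 0 d.+1).

Lemma admissible_lt d k : admissible d k -> 2 * k < d.
Proof. by move=> /and3P[]; lia. Qed.

Lemma has_idfP d k : 2 * k < d ->
  reflect (exists p, index_divisor_free d k p) (has_idf d k).
Proof.
move=> kd; apply: (iffP hasP) => [[p _ /and3P[pp kp /hasP[r rk /andP[pd nr]]]]|].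
  exists p; split=> //; exists r; split=> //.
  by move: rk; rewrite mem_iota.
move=> [p [pp kp [r [rk pd nr]]]]; exists p; last first.
  by apply/and3P; split=> //; apply/hasP; exists r; rewrite ?mem_iota ?ltnS // pd.
have dr : 0 < d - r by rewrite subn_gt0; lia.
by rewrite mem_iota ltnS (leq_trans (dvdn_leq dr pd)) ?leq_subr.
Qed.

Lemma exceptional_rough_powers d k : exceptional d k -> rough_powers k d.
Proof.
move=> [/admissible_lt kd no]; split=> // r q rk pq kq.
apply/negPn/negP => nr; apply: no; exists q; split=> //; exists r; split=> //.
by apply: contraNT nr => nqd; rewrite lognE (negbTE nqd) !andbF.
Qed.

Theorem proposition17 :
  {s : seq (nat * nat) |
    forall d k : nat, (d, k) \in s <-> exceptional d k}.
Proof.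
have [B HB] := rough_powers_bounded.
exists [seq x <- [seq (d, k) | d <- iota 0 B.+1, k <- iota 0 B.+1]
       | admissible x.1 x.2 && ~~ has_idf x.1 x.2] => d k.
rewrite mem_filter; split=> [/andP[/andP[/= adm no] _]|exc].
  by split=> //; apply/(has_idfP (admissible_lt adm)).
have [adm no] := exc; have kd := admissible_lt adm.
have dB : d <= B.
  have /and3P[d3 k1 _] := adm.
  by apply: (HB k d k1 _ (exceptional_rough_powers exc)); lia.
apply/andP; split; first by rewrite /= adm; apply/(has_idfP kd).
by apply: allpairs_f; rewrite mem_iota /=; lia.
Qed.
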